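(* Let $0<\alpha\le 1$, $\nu>0$, $0<p<1$, $q=1-p$, $\xi=p/q$. Let $N$ be an $\mathbb{N}$-valued random variable with $\mathbb{P}(N=k)=\frac{(\nu)_{k-1}}{(k-1)!}p^{\nu}q^{k-1}$ for $k\in\mathbb{N}$, let $Y_1,Y_2,\dots$ be i.i.d. (independent of $N$) with generating function $\mathbb{E}u^{Y_1}=1-(1-u)^{\alpha}$, and let $Z=\sum_{j=1}^{N}Y_j$. Then $$\mathbb{E}u^{Z}=\left(1-(1-u)^{\alpha}\right)\bar\varphi(u),\qquad \bar\varphi(u)=\frac{\xi^{\nu}}{(\xi+(1-u)^{\alpha})^{\nu}},\qquad |u|\le 1 .$$ Moreover, writing $\varphi(t)$ for the coefficient of $u^t$ in the power series of $\bar\varphi$ at $u=0$, one has for all $t\in\mathbb{N}_0$, with absolutely convergent series: (i) if $0<\xi<1$, $$\varphi(t)=\frac{\xi^{\nu}}{t!}\sum_{m=0}^{\infty}\frac{(-1)^m(\nu)_m\xi^m}{m!}(\alpha(m+\nu))_t,$$ $$\mathbb{P}(Z=t)=\frac{\xi^{\nu}}{t!}\sum_{m=0}^{\infty}\frac{(-1)^m(\nu)_m\xi^m}{m!}\Big((\alpha(m+\nu))_t-(\alpha(m-1+\nu))_t\Big);$$ (ii) if $\xi>1$, $$\varphi(t)=\frac{(-1)^t}{t!}\sum_{m=0}^{\infty}\frac{(-1)^m(\nu)_m\xi^{-m}}{m!}\,[\alpha m]_t,$$ $$\mathbb{P}(Z=t)=\frac{(-1)^t}{t!}\sum_{m=0}^{\infty}\frac{(-1)^m(\nu)_m\xi^{-m}}{m!}\Big([\alpha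 m]_t-[\alpha(m+1)]_t\Big).$$
   Context: $\mathbb{N}=\{1,2,\dots\}$, $\mathbb{N}_0=\{0,1,2,\dots\}$. Pochhammer symbol: $(c)_0=1$, $(c)_m=c(c+1)\cdots(c+m-1)$ for real $c$ (equal to $\Gamma(c+m)/\Gamma(c)$ when the latter is defined). Falling factorial: $[x]_0=1$, $[x]_t=x(x-1)\cdots(x-t+1)$ (equal to $\Gamma(x+1)/\Gamma(x-t+1)$, with $1/\Gamma$ understood as $0$ at its zeros). Powers $(1-u)^{\alpha}$ and $(\cdot)^{\nu}$ are principal branches. *)

(* Defs.v *)
From HB Require Import structures.
From mathcomp Require Import all_boot all_order all_algebra.
From mathcomp Require Import finmap.
From mathcomp Require Import complex.
From mathcomp Require Import all_classical all_reals all_analysis.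

Set Implicit Arguments.
Unset Strict Implicit.
Unset Printing Implicit Defensive.
Import Order.TTheory GRing.Theory Num.Theory.
Import numFieldNormedType.Exports.
Import ComplexField.Normc.

Local Open Scope classical_set_scope.
Local Open Scope complex_scope.
Local Open Scope ring_scope.

Definition pochhammer {R : realType} (c : R) (m : nat) : R :=
  \prod_(i < m) (c + i%:R).

Definition falling {R : realType} (x : R) (t : nat) : R :=
  \prod_(i < t) (x - i%:R).

(* The argument with values in ]-pi, pi] (with the value pi / 2 at z = 0,
   which is irrelevant below since the modulus vanishes there). *)
Definition carg {R : realType} (z : R[i]) : R :=
  let a := acos (complex.Re z / normc z) in
  if 0 <= complex.Im z then a else - a.

(* The principal branch of z ^ a for a real exponent a; 0 ^ a = 0 if a != 0,
   because powR does so. *)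
Definition cpow {R : realType} (z : R[i]) (a : R) : R[i] :=
  (normc z `^ a)%:C * (cos (a * carg z) +i* sin (a * carg z)).

Definition cexpectation {d : measure_display} {T : measurableType d}
    {R : realType} (P : probability T R) (f : T -> R[i]) : R[i] :=
  fine ('E_P[fun w => complex.Re (f w)])
    +i* fine ('E_P[fun w => complex.Im (f w)]).

Definition gen_fun {d : measure_display} {T : measurableType d}
    {R : realType} (P : probability T R) (X : T -> nat) (u : R[i]) : R[i] :=
  cexpectation P (fun w => u ^+ X w).

Definition mutually_independent {d : measure_display} {T : measurableType d}
    {R : realType} (P : probability T R) (X : nat -> T -> nat) : Prop :=
  forall (J : {fset nat}) (A : nat -> set nat), (forall i, measurable (A i)) ->
    P (\bigcap_(i in [set` J]) (X i @^-1` A i)) =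
      (\prod_(i <- J) P (X i @^-1` A i))%E.

Definition identically_distributed {d : measure_display}
    {T : measurableType d} {R : realType} (P : probability T R)
    (X : nat -> T -> nat) : Prop :=
  forall (i j : nat) (A : set nat), measurable A ->
    P (X i @^-1` A) = P (X j @^-1` A).

Definition sigma_of_seq {T : Type} (X : nat -> T -> nat) : set (set T) :=
  <<s [set E | exists i (A : set nat), measurable A /\ E = X i @^-1` A] >>.

Definition independent_of_seq {d : measure_display} {T : measurableType d}
    {R : realType} (P : probability T R) (N : T -> nat)
    (X : nat -> T -> nat) : Prop :=
  forall (B : set nat) (G : set T), measurable B -> sigma_of_seq X G ->
    P (N @^-1` B `&` G) = (P (N @^-1` B) * P G)%E.

(* The sequence Y_1, Y_2, ... is indexed from 0, so that Y j stands for
   Y_(j+1) and the sum below is Y_1 + ... + Y_N. *)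
Definition random_sum {T : Type} (N : T -> nat) (Y : nat -> T -> nat) (w : T)
    : nat :=
  (\sum_(j < N w) Y j w)%N.

Definition phibar {R : realType} (alpha nu xi : R) (u : R[i]) : R[i] :=
  (xi `^ nu)%:C / cpow (xi%:C + cpow (1 - u) alpha) nu.

(* c t is the coefficient of u ^ t in the power series of f at 0 (the
   coefficients are real in our use). *)
Definition power_series_at0 {R : realType} (f : R[i] -> R[i]) (c : nat -> R)
    : Prop :=
  exists2 r : R, 0 < r & forall u : R[i], `|u| < r%:C ->
    series (fun t => ((c t)%:C * u ^+ t : R[i]^o)) @ \oo --> (f u : R[i]^o).

Definition abs_sums_to {R : realType} (a : nat -> R) (s : R) : Prop :=
  cvgn [normed series a] /\ series a @ \oo --> s.

(* Main.v *)
Require Import Defs.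
From HB Require Import structures.
From mathcomp Require Import all_boot all_order all_algebra.
From mathcomp Require Import finmap.
From mathcomp Require Import complex.
From mathcomp Require Import all_classical all_reals all_analysis.
From mathcomp Require Import ring lra.
Import Order.TTheory GRing.Theory Num.Theory.
Import numFieldNormedType.Exports.
Import ComplexField.Normc.

Set Implicit Arguments.
Unset Strict Implicit.
Unset Printing Implicit Defensive.

Local Open Scope classical_set_scope.
Local Open Scope complex_scope.
Local Open Scope ring_scope.

                                                                                  
                                                                            
                               
                                                                              
                                                                            
                                                                            
                                                                             
                                                                              
                                                                              
                                                                           
                                                           
                                                                       

                                                                              
                                                                               
                                    

                    

(** Write v = (1 - u)^alpha and g = 1 - v. Conditioning on N gives E u^Z = g * sum_k P(N = k + 1)
    g^k. The weights are p^nu times the coefficients of the binomial series (1 - x)^(-nu) taken at x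
    = q g, and 1 - q g = q (xi + v), so the inner sum is p^nu / (q (xi + v))^nu = [phibar]
    ([phibar_mixture]). This holds on the whole closed disc, because |g| <= 1 there
    ([gen_fun_normc_le1]) and q < 1. It needs the binomial series for the principal branch at
    complex points ([complex_binomial_series]), the law of the random sum ([pmf_random_sum]) and an
    interchange of sums ([mixture_gen_fun]). The same interchange shows that [phibar] is the
    generating function of Y_1 + ... + Y_(N-1), hence a power series on the closed disc.

    For the explicit coefficients real u near 0 suffices, since a power series is determined by its
    values there ([power_series_unique]). For xi < 1 expand (xi + v)^(-nu) in powers of xi / v, for
    xi > 1 in powers of v / xi. Each term is a real power of 1 - u, which is expanded by the
    binomial series in turn. The double series is absolutely convergent for small u, so summing it
    by columns gives the coefficients ([coefficient_series]).

    The law of Z needs no separate computation: [phibar] minus the generating function of Z is v *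
    [phibar], which has an expansion of the same kind with the exponents shifted by alpha.
    Subtracting the two expansions gives the differences in the statement.

    Sums are expressed by [sums_to], which carries convergence and value together; complex sums are
    handled through their real and imaginary parts. *)

Definition sums_to {R : realType} (a : nat -> R) (s : R) : Prop :=
  series a @ \oo --> s.

(** * Real series: interchange of summations and uniqueness of power series *)

Section RealSeries.
Context {R : realType}.
Implicit Types (a b c r : nat -> R) (s t x : R).

Lemma eq_sums_to a b s : sums_to a s -> a =1 b -> sums_to b s.
Proof. by move=> + /funext <-. Qed.

Lemma sums_to_unique a s t : sums_to a s -> sums_to a t -> s = t.
Proof. by move=> h1 h2; exact: (cvg_unique _ h1 h2). Qed.

Lemma sums_toD a b s t :
  sums_to a s -> sums_to b t -> sums_to (fun n => a n + b n) (s + t).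
Proof. by move=> ha hb; rewrite /sums_to seriesD; exact: cvgD. Qed.

Lemma sums_toN a s : sums_to a s -> sums_to (fun n => - a n) (- s).
Proof. by move=> ha; rewrite /sums_to seriesN; exact: cvgN. Qed.

Lemma sums_toB a b s t :
  sums_to a s -> sums_to b t -> sums_to (fun n => a n - b n) (s - t).
Proof. by move=> ha hb; apply: sums_toD => //; exact: sums_toN. Qed.

Lemma sums_toZ a s x : sums_to a s -> sums_to (fun n => x * a n) (x * s).
Proof.
move=> ha; rewrite /sums_to.
by rewrite (_ : series _ = x *: series a) ?seriesZ//; exact: cvgZl_tmp.
Qed.

Lemma sums_toZr a s x : sums_to a s -> sums_to (fun n => a n * x) (s * x).
Proof.
move=> ha; rewrite (mulrC s); apply: (eq_sums_to (sums_toZ ha)) => n.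
by rewrite mulrC.
Qed.

Lemma sums_to_recl a s : sums_to (fun n => a n.+1) s -> sums_to a (a 0%N + s).
Proof.
move=> h; rewrite /sums_to -cvg_shiftS /=.
rewrite (_ : (fun n => _) = (fun n => a 0%N + series (fun n => a n.+1) n)).
  by apply: cvgD => //; exact: cvg_cst.
by apply/funext => n; rewrite /series/= big_nat_recl.
Qed.

Lemma sums_to_behead a s : sums_to a s -> sums_to (fun n => a n.+1) (s - a 0%N).
Proof.
move=> h; rewrite /sums_to.
rewrite (_ : series _ = (fun n => series a n.+1 - a 0%N)).
  by apply: cvgB; [rewrite cvg_shiftS | exact: cvg_cst].
by apply/funext => n; rewrite /series/= big_nat_recl// addrAC subrr add0r.
Qed.

Lemma sums_to_shift i a s :
  sums_to a s -> sums_to (fun n => if (i <= n)%N then a (n - i)%N else 0) s.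
Proof.
move=> h; elim: i => [|i ih].
  by apply: (eq_sums_to h) => n; rewrite subn0.
by rewrite -[s]add0r; exact: (@sums_to_recl (fun n => if (i < n)%N then _ else 0)).
Qed.

Lemma sums_to_finite k a :
  (forall n, (k <= n)%N -> a n = 0) -> sums_to a (\sum_(i < k) a i).
Proof.
move=> h; apply: cvg_near_cst; near=> n.
have kn : (k <= n)%N by near: n; exact: nbhs_infty_ge.
rewrite /series/= (big_cat_nat (leq0n k) kn)/= big_mkord [X in _ + X]big_nat.
by rewrite [X in _ + X]big1 ?addr0// => i /andP[/h].
Unshelve. all: by end_near. Qed.

Lemma sums_to_nneseries a s : (forall n, 0 <= a n) ->
  sums_to a s <-> (\sum_(n <oo) (a n)%:E = s%:E)%E.
Proof.
move=> a0.
have E : (fun n => \sum_(0 <= k < n) (a k)%:E)%E = EFin \o series a.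
  by apply/funext => n; rewrite /series/= sumEFin.
split=> [h|h].
  rewrite E; apply: cvg_lim => //; exact: cvg_EFin (nearW _ _) h.
have /cvg_ex[l hl] : cvgn (fun n => \sum_(0 <= k < n) (a k)%:E)%E.
  by apply: is_cvg_nneseries => n _ _; rewrite lee_fin.
have := cvg_lim _ hl; rewrite h => /(_ (@ereal_hausdorff R)) ls.
by move: hl; rewrite -ls E => /fine_cvg.
Qed.

Lemma sums_to_ge0 a s : (forall n, 0 <= a n) -> sums_to a s -> 0 <= s.
Proof.
move=> a0 /(sums_to_nneseries _ a0) h; rewrite -lee_fin -h.
by apply: nneseries_ge0 => n _ _; rewrite lee_fin.
Qed.

Lemma ge0_sums_to_term_le a s n : (forall n, 0 <= a n) -> sums_to a s -> a n <= s.
Proof.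
move=> a0 h.
have H : series a n.+1 <= s.
  rewrite -(cvg_lim _ h)//; apply: nondecreasing_cvgn_le; last by apply: cvgP h.
  exact: nondecreasing_series.
apply: le_trans H; rewrite /series/= big_nat_recr//= lerDr.
by apply: sumr_ge0 => i _.
Qed.

(** Tonelli: for nonnegative terms the interchange is available in the extended reals, and
    [sums_to_nneseries] translates it back. *)
Lemma sums_to_swap_ge0 (a : nat -> nat -> R) r c s :
  (forall m n, 0 <= a m n) ->
  (forall m, sums_to (a m) (r m)) -> sums_to r s ->
  (forall n, sums_to (a ^~ n) (c n)) -> sums_to c s.
Proof.
move=> a0 ha hr hc.
have r0 m : 0 <= r m by apply: sums_to_ge0 (ha m).
have c0 m : 0 <= c m by apply: sums_to_ge0 (hc m) => n.
apply/sums_to_nneseries => //; move/sums_to_nneseries : (hr) => <-//.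
under eq_eseriesr do rewrite -(iffLR (sums_to_nneseries _ _) (hc _))//.
under [RHS]eq_eseriesr do rewrite -(iffLR (sums_to_nneseries _ _) (ha _))//.
by rewrite nneseries_interchange// => i j; rewrite lee_fin.
Qed.

Lemma dominated_cvg_series a b :
  (forall n, `|a n| <= b n) -> cvgn (series b) -> cvgn [normed series a].
Proof.
move=> ab; apply: series_le_cvg => //= n.
exact: le_trans (normr_ge0 _) (ab n).
Qed.

Lemma dominated_sums_to a b : (forall n, `|a n| <= b n) -> cvgn (series b) ->
  exists s, sums_to a s.
Proof.
move=> ab cb; exists (limn (series a)).
exact: normed_cvg (dominated_cvg_series ab cb).
Qed.

(** Fubini from Tonelli: both b and a + b are nonnegative, so their sums may be interchanged, and
    subtraction leaves the claim for a. The columns of b converge because b m n <= B m. *)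
Lemma sums_to_swap (a b : nat -> nat -> R) B r c s :
  (forall m n, `|a m n| <= b m n) ->
  (forall m, sums_to (b m) (B m)) -> cvgn (series B) ->
  (forall m, sums_to (a m) (r m)) -> sums_to r s ->
  (forall n, sums_to (a ^~ n) (c n)) -> sums_to c s.
Proof.
move=> ab hb hB ha hr hc.
have b0 m n : 0 <= b m n by apply: le_trans (ab m n).
have bB m n : b m n <= B m by apply: ge0_sums_to_term_le (hb m).
have /choice[d hd] : forall n, exists t, sums_to (b ^~ n) t.
  move=> n; by apply: dominated_sums_to hB => m; rewrite ger0_norm.
have hs : sums_to d (limn (series B)) by apply: (sums_to_swap_ge0 b0 hb hB).
                                       
suff : sums_to (fun n => (d n + c n)) (limn (series B) + s).
  move=> /sums_toB /(_ hs); rewrite addrAC subrr add0r => /eq_sums_to; apply=> n.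
  by rewrite addrAC subrr add0r.
apply: (@sums_to_swap_ge0 (fun m n => b m n + a m n) (fun m => B m + r m)).
- by move=> m n; have := ab m n; rewrite ler_norml => /andP[]; lra.
- by move=> m; exact: sums_toD.
- exact: sums_toD.
- by move=> n; exact: sums_toD.
Qed.

Lemma dominated_column (a b : nat -> nat -> R) B n :
  (forall m n, `|a m n| <= b m n) ->
  (forall m, sums_to (b m) (B m)) -> cvgn (series B) ->
  cvgn [normed series (a ^~ n)].
Proof.
move=> ab hb; apply: dominated_cvg_series => m; apply: le_trans (ab m n) _.
by apply: ge0_sums_to_term_le (hb m) => k; apply: le_trans (ab m k).
Qed.

(** By strong induction the differences of the coefficients before n vanish. Dividing the difference
    series by u^n then gives a series with sum 0 for u != 0 and constant term d n; its other terms
    sum to O(u), so d n = 0. *)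
Lemma power_series_unique (r : R) a b : 0 < r ->
  (forall u : R, `|u| < r ->
    exists2 s, sums_to (fun n => a n * u ^+ n) s & sums_to (fun n => b n * u ^+ n) s) ->
  a = b.
Proof.
move=> r0 hab.
pose d n := a n - b n.
have hd (u : R) : `|u| < r -> sums_to (fun n => d n * u ^+ n) 0.
  move=> /hab[s ha hb]; rewrite -[0](subrr s).
  by apply: (eq_sums_to (sums_toB ha hb)) => n; rewrite mulrBl.
suff d0 n : d n = 0 by apply/funext => n; apply/eqP; rewrite -subr_eq0 -/(d n) d0.
elim/ltn_ind: n => n ih.
pose e k := d (n + k)%N.
have he (u : R) : u != 0 -> `|u| < r -> sums_to (fun k => e k * u ^+ k) 0.
  move=> u0 ur.
  have : sums_to (fun k => d (n + k)%N * u ^+ (n + k)) 0.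
    have H m : (m <= n)%N -> sums_to (fun k => d (m + k)%N * u ^+ (m + k)) 0.
      elim: m => [_|m ihm mn]; first exact: hd.
      have := sums_to_behead (ihm (ltnW mn)).
      rewrite addn0 ih// mul0r subr0 => /eq_sums_to; apply=> k.
      by rewrite addnS.
    exact: H.
  move=> /(@sums_toZ _ _ (u ^- n)); rewrite mulr0 => /eq_sums_to; apply=> k.
  by rewrite exprD mulrCA mulKf// expf_neq0.
have r2 : `|r / 2| < r by rewrite ger0_norm; lra.
have r20 : r / 2 != 0 by lra.
(* The terms of a convergent series are bounded, so |e k| <= K (r / 2)^(-k). At u = x r / 2 the tail
   is then dominated by a geometric series of ratio x. *)
have [M [Mr hM]] := cvg_series_bounded (cvgP _ (he _ r20 r2)).
pose K : R := `|M| + 1.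
have K0 : 0 < K by rewrite /K; have := normr_ge0 M; lra.
have eK k : `|e k| * (r / 2) ^+ k <= K.
  have : `|e k * (r / 2) ^+ k| <= K.
    by apply: hM => //; rewrite /K; have := ler_norm M; lra.
  by rewrite normrM normrX (ger0_norm (_ : 0 <= r / 2))//; lra.
have bound (x : R) : 0 < x -> x < 1/2 -> `|e 0%N| <= K * 2 * x.
  move=> x0 x1; have x10 : 0 < 1 - x by lra.
  have ux : `|x * (r / 2)| < r by rewrite ger0_norm; nra.
  have u0 : x * (r / 2) != 0 by rewrite mulf_neq0//; lra.
  have := sums_to_behead (he _ u0 ux); rewrite expr0 mulr1 add0r => h.
  have gK : sums_to (fun k => K * x ^+ k.+1) (K * x / (1 - x)).
    rewrite -mulrA; apply: sums_toZ.
    have := @cvg_geometric_series R x x; rewrite ger0_norm; last lra.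
    by move=> /(_ ltac:(lra)); move=> /eq_sums_to; apply=> k /=; rewrite exprS.
  have le1 k : `|e k.+1 * (x * (r / 2)) ^+ k.+1| <= K * x ^+ k.+1.
    rewrite normrM normrX (ger0_norm (_ : 0 <= x * (r / 2))); last nra.
    by rewrite exprMn mulrCA mulrC ler_wpM2r ?exprn_ge0 ?eK//; lra.
  have [Hle] : `|- e 0%N| <= K * x / (1 - x).
    rewrite ler_norml; apply/andP; split.
      rewrite -subr_ge0 opprK addrC.
      apply: (sums_to_ge0 _ (sums_toD gK h)) => k.
      by have := le1 k; rewrite ler_norml => /andP[]; lra.
    rewrite -subr_ge0; apply: (sums_to_ge0 _ (sums_toB gK h)) => k.
    by have := le1 k; rewrite ler_norml => /andP[]; lra.
  rewrite normrN in Hle; apply: le_trans Hle _.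
  have : 0 <= (K * x) * (1 - 2 * x) by rewrite !mulr_ge0//; lra.
  by rewrite ler_pdivrMr//; lra.
apply/eqP; rewrite -normr_le0 -[n]addn0 -/(e 0%N).
apply/ler_addgt0Pr => eps eps0; rewrite add0r.
(* This x meets the constraint x < 1/2 and makes the bound 2 K x at most eps. *)
pose x : R := Num.min (1 / 4) (eps / (K * 2)).
have xe : x <= eps / (K * 2) by rewrite ge_min lexx orbT.
have K2 : 0 < K * 2 by lra.
have := bound x; move: xe; rewrite ler_pdivlMr// => xe.
move=> /(_ _ _) H; apply: le_trans (H _ _) _; last by rewrite mulrC.
  by rewrite lt_min (divr_gt0 eps0 K2) andbT; lra.
by rewrite gt_min; apply/orP; left; lra.
Qed.

End RealSeries.

                       

(** * Real and imaginary parts, and the principal power *)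

Section ComplexComponents.
Context {R : realType}.
Implicit Types (z w : R[i]) (x y : R).

Lemma cReM z w : complex.Re (z * w) =
  complex.Re z * complex.Re w - complex.Im z * complex.Im w.
Proof. by case: z w => [? ?] [? ?]. Qed.

Lemma cImM z w : complex.Im (z * w) =
  complex.Re z * complex.Im w + complex.Im z * complex.Re w.
Proof. by case: z w => [? ?] [? ?]. Qed.

Lemma cReD z w : complex.Re (z + w) = complex.Re z + complex.Re w.
Proof. by case: z w => [? ?] [? ?]. Qed.

Lemma cImD z w : complex.Im (z + w) = complex.Im z + complex.Im w.
Proof. by case: z w => [? ?] [? ?]. Qed.

Lemma cReB z w : complex.Re (z - w) = complex.Re z - complex.Re w.
Proof. by case: z w => [? ?] [? ?]. Qed.

Lemma cImB z w : complex.Im (z - w) = complex.Im z - complex.Im w.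
Proof. by case: z w => [? ?] [? ?]. Qed.

Lemma sqr_normc z : normc z ^+ 2 = complex.Re z ^+ 2 + complex.Im z ^+ 2.
Proof. by case: z => a b /=; rewrite sqr_sqrtr// addr_ge0// sqr_ge0. Qed.

Lemma normc_ge0 z : 0 <= normc z.
Proof. by case: z => a b /=; rewrite sqrtr_ge0. Qed.

Lemma Re_le_normc z : `|complex.Re z| <= normc z.
Proof.
rewrite -(@ler_pXn2r _ 2)// ?nnegrE ?normc_ge0// sqr_normc.
by rewrite real_normK ?num_real// lerDl sqr_ge0.
Qed.

Lemma normcX z n : normc (z ^+ n) = normc z ^+ n.
Proof.
by elim: n => [|n ih]; rewrite ?expr0 ?normc1// !exprS normcM ih.
Qed.

Lemma normC_real z : `|z| = (normc z)%:C.
Proof. by []. Qed.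

(** The angle t = atan (b / a) satisfies cos t = a / |z| and has the sign of b, which fixes the
    branch of acos. In this form the argument can be differentiated. *)
Lemma carg_atan z : 0 < complex.Re z ->
  carg z = atan (complex.Im z / complex.Re z).
Proof.
case: z => a b /= a0; rewrite /carg /=.
set t := atan (b / a).
have n0 : 0 < a ^+ 2 + b ^+ 2.
  by rewrite ltr_pwDl ?exprn_gt0// sqr_ge0.
have ct : a / Num.sqrt (a ^+ 2 + b ^+ 2) = cos t.
  rewrite /t cos_atan.
  have -> : 1 + (b / a) ^+ 2 = (a ^+ 2 + b ^+ 2) / a ^+ 2.
    by field; rewrite gt_eqF.
  rewrite sqrtrM ?ltW// sqrtrV ?sqr_ge0// sqrtr_sqr gtr0_norm// invfM invrK.
  by rewrite mulrC.
have pi_half : pi / 2 <= pi :> R by have := pi_gt0 R; lra.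
have tl : - (pi / 2) < t by exact: atan_gtNpi2.
have tu : t < pi / 2 by exact: atan_ltpi2.
rewrite ct; case: (leP 0 b) => b0.
  have t0 : 0 <= t by rewrite /t -atan0 le_atan// divr_ge0// ltW.
  by rewrite cosK// in_itv/= t0; lra.
have t0 : t <= 0.
  by rewrite /t -atan0 le_atan// pmulr_lle0 ?invr_gt0// ltW.
by rewrite cosKN ?opprK// t0; lra.
Qed.

Lemma cpow_Re_gt0 z c : 0 < complex.Re z ->
  let E := expR (c / 2 * ln (complex.Re z ^+ 2 + complex.Im z ^+ 2)) in
  let t := c * atan (complex.Im z / complex.Re z) in
  cpow z c = (E * cos t) +i* (E * sin t).
Proof.
move=> z0 E t; rewrite /cpow carg_atan// -/t.
have n0 : 0 < complex.Re z ^+ 2 + complex.Im z ^+ 2.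
  by rewrite ltr_pwDl ?exprn_gt0// sqr_ge0.
have -> : normc z `^ c = E.
  rewrite (_ : normc z = (complex.Re z ^+ 2 + complex.Im z ^+ 2) `^ (2^-1)).
    by rewrite -powRrM /powR gt_eqF// /E mulrC [c / 2]mulrC mulrC.
  by case: (z) => a b /=; rewrite powR12_sqrt// addr_ge0// sqr_ge0.
by apply/eqP; rewrite eq_complex /= !mul0r subr0 addr0 !eqxx.
Qed.

Lemma cpow_gt0 x c : 0 < x -> cpow x%:C c = (x `^ c)%:C.
Proof.
move=> x0; rewrite /cpow carg_atan//= mul0r atan0 mulr0 cos0 sin0.
rewrite expr0n/= addr0 sqrtr_sqr gtr0_norm//.
by apply/eqP; rewrite eq_complex /= !(mulr0, mul0r, mulr1, subr0, addr0) !eqxx.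
Qed.

(** A positive factor does not change the argument, so here the principal power is multiplicative,
    which it is not for arbitrary complex factors. *)
Lemma cpow_scale x z c : 0 < x -> cpow (x%:C * z) c = (x `^ c)%:C * cpow z c.
Proof.
move=> x0; have nx : normc x%:C = x by rewrite /= expr0n/= addr0 sqrtr_sqr gtr0_norm.
rewrite /cpow /carg normcM nx (powRM _ (ltW x0) (normc_ge0 z)).
have -> : complex.Re (x%:C * z) = x * complex.Re z by rewrite cReM/= mul0r subr0.
have -> : complex.Im (x%:C * z) = x * complex.Im z by rewrite cImM/= mul0r addr0.
rewrite pmulr_rge0// invfM mulrACA mulfV ?gt_eqF// mul1r.
by rewrite mulrA rmorphM.
Qed.

Lemma cpow_neq0 z c : z != 0 -> cpow z c != 0.
Proof.
move=> z0; rewrite /cpow mulf_neq0//.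
  rewrite -[0]/(0%:C) (inj_eq (@complexI _)) gt_eqF// powR_gt0//.
  rewrite lt_def normc_ge0 andbT.
  by apply: contra z0 => /eqP /eq0_normc ->.
rewrite eq_complex/=; set t := _ * _; apply/negP => /andP[/eqP h1 /eqP h2].
by have := cos2Dsin2 t; rewrite h1 h2 expr0n/= addr0 => /eqP; rewrite eq_sym oner_eq0.
Qed.

End ComplexComponents.

                            

(** Componentwise, so that the results on real series apply directly; [csums_toP] relates this to
    convergence in [R[i]]. *)
Definition csums_to {R : realType} (a : nat -> R[i]) (s : R[i]) : Prop :=
  sums_to (fun n => complex.Re (a n)) (complex.Re s) /\
  sums_to (fun n => complex.Im (a n)) (complex.Im s).

(** The coefficient of z^m in (1 - z)^(-c). *)
Definition binom_coef {R : realType} (c : R) (m : nat) : R :=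
  pochhammer c m / m`!%:R.

(** * Coefficients of the binomial series *)

Section BinomCoef.
Context {R : realType}.
Implicit Types (c x : R) (m : nat).

Lemma pochhammer0 c : pochhammer c 0 = 1.
Proof. by rewrite /pochhammer big_ord0. Qed.

Lemma pochhammerS c m : pochhammer c m.+1 = pochhammer c m * (c + m%:R).
Proof. by rewrite /pochhammer big_ord_recr. Qed.

Lemma pochhammerSl c m : pochhammer c m.+1 = c * pochhammer (c + 1) m.
Proof.
rewrite /pochhammer big_ord_recl addr0; congr (_ * _); apply: eq_bigr => i _.
by rewrite -addrA -natr1 [1 + _]addrC.
Qed.

Lemma binom_coef0 c : binom_coef c 0 = 1.
Proof. by rewrite /binom_coef pochhammer0 fact0 divr1. Qed.

Lemma binom_coefSl c m : m.+1%:R * binom_coef c m.+1 = c * binom_coef (c + 1) m.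
Proof.
rewrite /binom_coef pochhammerSl factS natrM.
by field; rewrite pnatr_eq0 -lt0n fact_gt0 nat1r pnatr_eq0.
Qed.

(** Coefficientwise form of (1 - z)^(-c-1) = z (1 - z)^(-c-1) + (1 - z)^(-c). *)
Lemma binom_coef_pascal c m :
  binom_coef (c + 1) m.+1 = binom_coef (c + 1) m + binom_coef c m.+1.
Proof.
rewrite /binom_coef (pochhammerSl c) (pochhammerS (c + 1)) factS natrM -natr1.
by field; rewrite pnatr_eq0 -lt0n fact_gt0 natr1 pnatr_eq0.
Qed.

Lemma pochhammer_le c x m : `|c| <= x -> `|pochhammer c m| <= pochhammer x m.
Proof.
move=> cx; elim: m => [|m ih]; first by rewrite !pochhammer0 normr1.
rewrite !pochhammerS normrM ler_pM//.
by apply: le_trans (ler_normD _ _) _; rewrite normr_nat lerD2r.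
Qed.

Lemma binom_coef_le c x m : `|c| <= x -> `|binom_coef c m| <= binom_coef x m.
Proof.
move=> cx; rewrite /binom_coef normrM normfV normr_nat ler_wpM2r ?invr_ge0//.
exact: pochhammer_le.
Qed.

Lemma binom_coef_ge0 c m : 0 <= c -> 0 <= binom_coef c m.
Proof.
by move=> c0; apply: le_trans (normr_ge0 _) (binom_coef_le m (_ : `|c| <= c)); rewrite ger0_norm.
Qed.

(** Induction on n: by Pascal's rule the partial sums S' for n + 1 and S for n satisfy S'(m+1) = x
    S'(m) + S(m+1). As S' is nondecreasing, it is bounded by lim S / (1 - x). *)
Lemma cvg_binom_coef_nat n x : 0 <= x -> x < 1 ->
  cvgn (series (fun m => binom_coef (n%:R : R) m * x ^+ m)).
Proof.
move=> x0 x1; elim: n => [|n ih].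
  apply: (cvgP (\sum_(i < 1) binom_coef 0 i * x ^+ i)).
  apply: (sums_to_finite (k := 1)) => -[//|m] _.
  by rewrite /binom_coef pochhammerSl !mul0r.
set a := fun m => _ in ih.
set b := fun m => _.
have b0 m : 0 <= b m by rewrite mulr_ge0 ?exprn_ge0// binom_coef_ge0.
have a0 m : 0 <= a m by rewrite mulr_ge0 ?exprn_ge0// binom_coef_ge0.
have ndb : {homo series b : i j / (i <= j)%N >-> i <= j}.
  by apply/nondecreasing_seqP => m; rewrite /series/= big_nat_recr//= lerDl.
have E m : series b m.+1 = x * series b m + series a m.+1.
  rewrite /series/= !(big_nat_recl m)// /a /b expr0 !binom_coef0.
  rewrite addrCA; congr (_ + _); rewrite mulr_sumr -big_split/=.
  apply: eq_bigr => i _; rewrite -natr1 binom_coef_pascal exprS.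
  by ring.
have [M aM] := cvg_seq_bounded ih.
apply: nondecreasing_is_cvgn => //.
exists (limn (series a) / (1 - x)) => _ [m _ <-].
rewrite ler_pdivlMr; last lra.
have : series a m.+1 <= limn (series a).
  apply: nondecreasing_cvgn_le => //.
  by apply/nondecreasing_seqP => k; rewrite /series/= big_nat_recr//= lerDl.
have := ndb _ _ (leqnSn m); rewrite E; lra.
Qed.

Lemma cvg_binom_coef c x : `|x| < 1 ->
  cvgn (series (fun m => `|binom_coef c m| * `|x| ^+ m)).
Proof.
move=> x1; have [n cn] : exists n : nat, `|c| <= n%:R.
  by exists (Num.bound `|c|); rewrite ltW// archi_boundP.
apply: (series_le_cvg _ _ _ (@cvg_binom_coef_nat n _ (normr_ge0 x) x1)) => m.
- by rewrite mulr_ge0// exprn_ge0.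
- by rewrite mulr_ge0 ?exprn_ge0// binom_coef_ge0.
- by rewrite ler_wpM2r ?exprn_ge0// binom_coef_le.
Qed.

End BinomCoef.

(** * The complex binomial series, by a differential equation along a segment *)

Section ComplexBinomialSeries.
Context {R : realType}.
Variable z : R[i].
Implicit Types (c s : R) (w : R[i]).

(** Let f_c be the sum of the binomial series with exponent -c. Fixing z and varying the real s
    turns f_c(s z) into real power series in s: [F c w s] is Re (w f_c(s z)), so w = 1 gives the
    real part and w = - 'i the imaginary part. *)
Let coef c w m : R := binom_coef c m * complex.Re (w * z ^+ m).
                                                                               
                                                                             
Let F c w s : R := limn (pseries (coef c w) s).

Let F_sums c w s : `|s| * normc z < 1 ->
  sums_to (fun m => coef c w m * s ^+ m) (F c w s).
Proof.
move=> sz.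
have ns : `|s * normc z| < 1 by rewrite normrM (ger0_norm (normc_ge0 _)).
suff : cvgn (pseries (coef c w) s) by [].
apply: normed_cvg.
apply: (@dominated_cvg_series _ _
  (fun m => normc w * (`|binom_coef c m| * `|s * normc z| ^+ m))).
  move=> m; rewrite /coef normrM (normrM (binom_coef c m)) (normrM s) normrX exprMn.
  rewrite (ger0_norm (normc_ge0 z)).
  have : `|complex.Re (w * z ^+ m)| <= normc w * normc z ^+ m.
    by rewrite -normcX -normcM Re_le_normc.
  move=> h; rewrite [leRHS](_ : _ = `|binom_coef c m| * (normc w * normc z ^+ m) * `|s| ^+ m);
    last ring.
  by rewrite ler_wpM2r ?exprn_ge0// ler_wpM2l.
have /cvg_ex[l hl] := @cvg_binom_coef _ c _ ns.
exact: cvgP (@sums_toZ _ _ _ (normc w) hl).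
Qed.

Let F_linear c w s : `|s| * normc z < 1 ->
  F c w s = complex.Re w * F c 1 s + - complex.Im w * F c (- 'i) s.
Proof.
move=> sz; apply: sums_to_unique (@F_sums c w _ sz) _.
apply: (eq_sums_to (sums_toD (@sums_toZ _ _ _ (complex.Re w) (@F_sums c 1 _ sz))
  (@sums_toZ _ _ _ (- complex.Im w) (@F_sums c (- 'i) _ sz)))) => m.
by rewrite /coef !cReM /=; ring.
Qed.

Let F_pascal c w s : `|s| * normc z < 1 ->
  F (c + 1) w s = s * F (c + 1) (w * z) s + F c w s.
Proof.
move=> sz.
have h1 := sums_to_behead (@F_sums (c + 1) w _ sz).
have h2 := sums_toD (@sums_toZ _ _ _ s (@F_sums (c + 1) (w * z) _ sz))
  (sums_to_behead (@F_sums c w _ sz)).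
have : F (c + 1) w s - coef (c + 1) w 0 * s ^+ 0 =
   s * F (c + 1) (w * z) s + (F c w s - coef c w 0 * s ^+ 0).
  apply: sums_to_unique h1 _; apply: (eq_sums_to h2) => m.
  rewrite /coef -(mulrA w) -exprS binom_coef_pascal [s ^+ m.+1]exprS; ring.
by rewrite /coef !binom_coef0 !expr0 !mulr1 !mul1r; lra.
Qed.

Let pseries_diffs_coef c w :
  pseries_diffs (coef c w) = (fun m => c * coef (c + 1) (w * z) m).
Proof.
apply/funext => m; rewrite /pseries_diffs /coef mulrA binom_coefSl.
by rewrite exprS !mulrA.
Qed.

(** Termwise differentiation: d/ds f_c(s z) = c z f_(c+1)(s z). *)
Let F_derive c w s : `|s| * normc z < 1 ->
  is_derive s 1 (F c w) (c * F (c + 1) (w * z) s).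
Proof.
move=> sz.
(* Termwise differentiation needs convergence at a point K beyond s. The midpoint of |s| and 1 / |z|
   serves, except for z = 0, where any larger number does. *)
have [K sK Kz] : exists2 K : R, `|s| < `|K| & `|K| * normc z < 1.
  have [z0|z0] := eqVneq (normc z) 0.
    by exists (`|s| + 1); rewrite ?z0 ?mulr0// [ltRHS]ger0_norm ?addr_ge0// ltrDl.
  have zp : 0 < normc z by rewrite lt_def z0 normc_ge0.
  have sz' : `|s| < (normc z)^-1 by rewrite -[ltRHS]mul1r ltr_pdivlMr.
  have iz : 0 < (normc z)^-1 by rewrite invr_gt0.
  have := normr_ge0 s => s0.
  exists ((`|s| + (normc z)^-1) / 2).
    by rewrite [ltRHS]ger0_norm; lra.
  rewrite (ger0_norm (_ : 0 <= (_ + _) / 2)); last lra.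
  by rewrite -ltr_pdivlMr//; lra.
have diffs_sums c' w' x : sums_to (fun m => coef (c' + 1) (w' * z) m * x ^+ m)
    (F (c' + 1) (w' * z) x) ->
    sums_to (fun m => pseries_diffs (coef c' w') m * x ^+ m)
      (c' * F (c' + 1) (w' * z) x).
  move=> /(@sums_toZ _ _ _ c') h; apply: (eq_sums_to h) => m.
  by rewrite pseries_diffs_coef mulrA.
have -> : c * F (c + 1) (w * z) s = limn (pseries (pseries_diffs (coef c w)) s).
  apply/esym/cvg_lim => //.
  exact: diffs_sums (@F_sums _ _ _ sz).
apply: (@pseries_snd_diffs _ _ K) => //.
- exact: cvgP (@F_sums _ _ _ Kz).
- exact: cvgP (diffs_sums _ _ _ (@F_sums _ _ _ Kz)).
- rewrite pseries_diffs_coef.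
  have -> : pseries_diffs (fun m => c * coef (c + 1) (w * z) m) =
      (fun m => c * pseries_diffs (coef (c + 1) (w * z)) m).
    by apply/funext => m; rewrite /pseries_diffs mulrCA.
  have h := diffs_sums _ _ _ (@F_sums (c + 1 + 1) (w * z * z) _ Kz).
  apply: (cvgP (c * ((c + 1) * F (c + 1 + 1) (w * z * z) K))).
  by apply: (eq_sums_to (sums_toZ h)) => m; rewrite mulrA.
Qed.

Let x := complex.Re z.
Let y := complex.Im z.
(** With n = |1 - s z|^2, the functions E = |1 - s z|^c and t = c arg (1 - s z) are the modulus and
    the angle of (1 - s z)^c. *)
Let n s := (1 - s * x) ^+ 2 + (- (s * y)) ^+ 2.
Let E c s := expR (c / 2 * ln (n s)).
Let t c s := c * atan (- (s * y) / (1 - s * x)).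

Let E_derive c s : 0 < 1 - s * x ->
  is_derive s 1 (E c) (E c s * (c * ((1 - s * x) * - x + - (s * y) * - y) / n s)).
Proof.
move=> a0.
have n0 : 0 < n s by rewrite ltr_pwDl ?exprn_gt0// sqr_ge0.
have dn : is_derive s 1 n (2 * ((1 - s * x) * - x + - (s * y) * - y)).
  rewrite /n; apply: is_derive_eq.
  by rewrite /GRing.scale/=; ring.
have dl := is_derive1_comp (is_derive1_ln n0) dn.
have dz := is_deriveZ (c / 2) dl.
have de := is_derive1_comp (is_derive_expR _) dz.
apply: (is_derive_eq de).
by rewrite /GRing.scale/= /E; field; rewrite gt_eqF.
Qed.

Let t_derive c s : 0 < 1 - s * x ->
  is_derive s 1 (t c) (c * (- y * (1 - s * x) - - (s * y) * - x) / n s).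
Proof.
move=> a0.
have n0 : 0 < n s by rewrite ltr_pwDl ?exprn_gt0// sqr_ge0.
have dv : is_derive s 1 (fun s => (1 - s * x)^-1) (- (1 - s * x) ^- 2 *: - x).
  apply: is_deriveV; first by rewrite gt_eqF.
  by apply: is_derive_eq; rewrite /GRing.scale/=; ring.
have dq : is_derive s 1 (fun s => - (s * y) / (1 - s * x))
   (- y * (1 - s * x)^-1 + - (s * y) * (- (1 - s * x) ^- 2 * - x)).
  by apply: is_derive_eq; rewrite /GRing.scale/=; ring.
have da := is_derive1_comp (is_derive1_atan _) dq.
apply: (is_derive_eq (is_deriveZ c da)).
rewrite /GRing.scale/= /n; field.
by rewrite gt_eqF//=; move: n0; rewrite /n => n0; rewrite gt_eqF//; lra.
Qed.

                                                                          
(** [G1] and [G2] are the real and imaginary parts of (1 - s z)^c f_c(s z). *)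
Let G1 c s := E c s * (F c 1 s * cos (t c s) - F c (- 'i) s * sin (t c s)).
Let G2 c s := E c s * (F c 1 s * sin (t c s) + F c (- 'i) s * cos (t c s)).

Let s_Re_lt1 s : `|s| * normc z < 1 -> 0 < 1 - s * x.
Proof.
move=> sz; have h : `|s * x| <= `|s| * normc z.
  by rewrite normrM ler_wpM2l// Re_le_normc.
by have := le_lt_trans (le_trans (ler_norm _) h) sz; lra.
Qed.

(** The derivative of (1 - s z)^c f_c is c z (1 - s z)^(c-1) ((1 - s z) f_(c+1) - f_c), and the last
    factor vanishes by Pascal's rule. *)
Let G_derive c s : `|s| * normc z < 1 ->
  is_derive s 1 (G1 c) 0 /\ is_derive s 1 (G2 c) 0.
Proof.
move=> sz; have a0 := s_Re_lt1 sz.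
have n0 : 0 < n s by rewrite ltr_pwDl ?exprn_gt0// sqr_ge0.
have iE : - 'i * z = y +i* (- x).
  by rewrite /x /y; case: (z) => u v; apply/eqP; rewrite eq_complex/=;
    apply/andP; split; apply/eqP; ring.
have dA := @F_derive c 1 _ sz; have dB := @F_derive c (- 'i) _ sz.
have A1 : F (c + 1) (1 * z) s = x * F (c + 1) 1 s + - y * F (c + 1) (- 'i) s.
  by rewrite mul1r (F_linear _ z sz).
have B1 : F (c + 1) (- 'i * z) s = y * F (c + 1) 1 s + x * F (c + 1) (- 'i) s.
  by rewrite iE (F_linear _ _ sz)/= opprK.
have A0 := @F_pascal c 1 _ sz; have B0 := @F_pascal c (- 'i) _ sz.
rewrite A1 in dA A0; rewrite B1 in dB B0.
have dt := @t_derive c _ a0; have dE := @E_derive c _ a0.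
have dc := is_derive1_comp (is_derive_cos _) dt.
have ds := is_derive1_comp (is_derive_sin _) dt.
(* C and D are the components of f_(c+1)(s z); the next facts are f_c = (1 - s z) f_(c+1) in
   components, after which only a rational identity remains. *)
set C := F (c + 1) 1 s in dA dB A0 B0.
set D := F (c + 1) (- 'i) s in dA dB A0 B0.
have {}A0 : F c 1 s = (1 - s * x) * C + s * y * D by lra.
have {}B0 : F c (- 'i) s = (1 - s * x) * D - s * y * C by lra.
split.
- apply: (is_derive_eq (is_deriveM dE (is_deriveB (is_deriveM dA dc) (is_deriveM dB ds)))).
  rewrite /GRing.scale/= -[(_ - _) s]/(F c 1 s * cos (t c s) - F c (- 'i) s * sin (t c s)) A0 B0.
  move: n0; rewrite /n => n0.
  field; rewrite gt_eqF//; lra.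
- apply: (is_derive_eq (is_deriveM dE (is_deriveD (is_deriveM dA ds) (is_deriveM dB dc)))).
  rewrite /GRing.scale/= -[(_ + _) s]/(F c 1 s * sin (t c s) + F c (- 'i) s * cos (t c s)) A0 B0.
  move: n0; rewrite /n => n0.
  field; rewrite gt_eqF//; lra.
Qed.

Let eq_at_endpoints (f : R -> R) :
  (forall s, 0 <= s <= 1 -> is_derive s 1 f 0) -> f 1 = f 0.
Proof.
move=> df; have [||v _] := @MVT_segment R f (fun=> 0) 0 1 ler01.
- by move=> s; rewrite in_itv/= => /andP[? ?]; apply: df; lra.
- apply: derivable_within_continuous => s; rewrite in_itv/= => s01.
  by have [] := df s s01.
- by rewrite mul0r => /eqP; rewrite subr_eq0 => /eqP.
Qed.

(** The product (1 - s z)^c f_c(s z) is constant on [0, 1] and equals 1 at s = 0, so at s = 1 the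
    series is the inverse of the principal power. *)
Lemma complex_binomial_series c : normc z < 1 ->
  csums_to (fun m => (binom_coef c m)%:C * z ^+ m) (cpow (1 - z) c)^-1.
Proof.
move=> z1.
have sz s : 0 <= s <= 1 -> `|s| * normc z < 1.
  move=> /andP[s0 s1]; rewrite ger0_norm//.
  by apply: le_lt_trans z1; rewrite ler_piMl// normc_ge0.
have s1 : `|1 : R| * normc z < 1 by rewrite normr1 mul1r.
have F0 w : F c w 0 = complex.Re w.
  have s0 : `|0 : R| * normc z < 1 by rewrite normr0 mul0r.
  apply: sums_to_unique (@F_sums c w _ s0) _.
  rewrite [complex.Re w](_ : _ = \sum_(m < 1) coef c w m * 0 ^+ m).
    apply: sums_to_finite => -[//|m] _.
    by rewrite exprS mul0r mulr0.
  by rewrite big_ord1 /coef binom_coef0 !expr0 !mulr1 mul1r.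
have E0 : E c 0 = 1.
  by rewrite /E /n !mul0r oppr0 addr0 expr1n expr0n addr0 ln1 mulr0 expR0.
have t0 : t c 0 = 0 by rewrite /t !mul0r oppr0 mul0r atan0 mulr0.
have h1 : G1 c 1 = 1.
  rewrite (eq_at_endpoints (fun s hs => (G_derive c (sz s hs)).1)).
  by rewrite /G1 !F0 E0 t0 /= cos0 sin0; ring.
have h2 : G2 c 1 = 0.
  rewrite (eq_at_endpoints (fun s hs => (G_derive c (sz s hs)).2)).
  by rewrite /G2 !F0 E0 t0 /= cos0 sin0; ring.
have cE : cpow (1 - z) c = (E c 1 * cos (t c 1)) +i* (E c 1 * sin (t c 1)).
  have x1 := s_Re_lt1 s1; rewrite mul1r in x1.
  rewrite cpow_Re_gt0 cReB//= cImB/=.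
  by rewrite /E /t /n !mul1r -/x -/y sub0r.
have FE : F c 1 1 +i* F c (- 'i) 1 = (cpow (1 - z) c)^-1.
  apply: (mulIf (_ : cpow (1 - z) c != 0)).
    by apply: cpow_neq0; apply: contraTneq z1 => /subr0_eq <-; rewrite normc1 ltxx.
  rewrite mulVf.
    rewrite cE; apply/eqP; rewrite eq_complex/=; apply/andP.
    by split; apply/eqP; [apply: etrans h1 | apply: etrans h2]; rewrite /G1 /G2; ring.
  by apply: cpow_neq0; apply: contraTneq z1 => /subr0_eq <-; rewrite normc1 ltxx.
rewrite -FE; split => /=.
  apply: (eq_sums_to (@F_sums c 1 _ s1)) => m.
  by rewrite /coef expr1n mulr1 mul1r cReM/= mul0r subr0.
apply: (eq_sums_to (@F_sums c (- 'i) _ s1)) => m.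
by rewrite /coef expr1n mulr1 !cReM cImM/=; ring.
Qed.

End ComplexBinomialSeries.

Section RealBinomialSeries.
Context {R : realType}.

Lemma real_binomial_series (c x : R) : `|x| < 1 ->
  sums_to (fun m => binom_coef c m * x ^+ m) ((1 - x) `^ (- c)).
Proof.
move=> x1; have nx : normc x%:C < 1 by rewrite /= expr0n/= addr0 sqrtr_sqr.
have [h _] := complex_binomial_series c nx.
have x0 : 0 < 1 - x by have := ler_norm x; lra.
move: h; rewrite -(rmorph1 (real_complex R)) -rmorphB cpow_gt0//.
rewrite -fmorphV/= powRN => h; apply: (eq_sums_to h) => m.
by rewrite -rmorphXn -rmorphM.
Qed.

End RealBinomialSeries.

                                                   

(** The k-fold convolution of y, that is, the law of a sum of k independent variables of law y; for
    k = 0 it is the unit mass at 0. *)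
Fixpoint conv_power {R : realType} (y : nat -> R) (k n : nat) : R :=
  if k is k'.+1 then \sum_(i < n.+1) conv_power y k' i * y (n - i)%N
  else (n == 0%N)%:R.

(** * Complex series by components *)

Section ComplexSeries.
Context {R : realType}.
Implicit Types (a c r : nat -> R[i]) (s t x : R[i]).

Lemma eq_csums_to a c s : csums_to a s -> a =1 c -> csums_to c s.
Proof. by move=> + /funext <-. Qed.

Lemma csums_to_unique a s t : csums_to a s -> csums_to a t -> s = t.
Proof.
case: s t => [s1 s2] [t1 t2] [h1 h2] [h3 h4].
by congr (_ +i* _); [exact: sums_to_unique h1 h3 | exact: sums_to_unique h2 h4].
Qed.

Lemma csums_to_real (a : nat -> R) (s : R) :
  sums_to a s -> csums_to (fun n => (a n)%:C) s%:C.
Proof.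
move=> h; split=> //=; have := @sums_to_finite R 0 (fun=> 0) (fun _ _ => erefl).
by rewrite big_ord0.
Qed.

Lemma csums_toZ a s x : csums_to a s -> csums_to (fun n => x * a n) (x * s).
Proof.
move=> [h1 h2]; split.
  rewrite cReM; apply: (eq_sums_to (sums_toB (@sums_toZ _ _ _ (complex.Re x) h1)
    (@sums_toZ _ _ _ (complex.Im x) h2))) => n.
  by rewrite cReM.
rewrite cImM; apply: (eq_sums_to (sums_toD (@sums_toZ _ _ _ (complex.Re x) h2)
  (@sums_toZ _ _ _ (complex.Im x) h1))) => n.
by rewrite cImM.
Qed.

Lemma Re_sum (I : Type) (l : seq I) (a : I -> R[i]) :
  complex.Re (\sum_(i <- l) a i) = \sum_(i <- l) complex.Re (a i).
Proof. by elim/big_ind2 : _ => // x1 x2 y1 y2 <- <-; rewrite cReD. Qed.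

Lemma Im_sum (I : Type) (l : seq I) (a : I -> R[i]) :
  complex.Im (\sum_(i <- l) a i) = \sum_(i <- l) complex.Im (a i).
Proof. by elim/big_ind2 : _ => // x1 x2 y1 y2 <- <-; rewrite cImD. Qed.

Lemma csums_to_finite k a :
  (forall n, (k <= n)%N -> a n = 0) -> csums_to a (\sum_(i < k) a i).
Proof.
by move=> h; split; rewrite (Re_sum, Im_sum); apply: sums_to_finite => n /h ->.
Qed.

Lemma csums_to_shift i a s :
  csums_to a s -> csums_to (fun n => if (i <= n)%N then a (n - i)%N else 0) s.
Proof.
move=> [h1 h2]; split.
  by apply: (eq_sums_to (sums_to_shift i h1)) => n; case: ifP.
by apply: (eq_sums_to (sums_to_shift i h2)) => n; case: ifP.
Qed.

Lemma Im_le_normc x : `|complex.Im x| <= normc x.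
Proof.
by have := Re_le_normc ('i * x); rewrite normcM cReM /= mul0r mul1r sub0r normrN
  expr0n expr1n add0r sqrtr1 mul1r.
Qed.

Lemma csums_to_swap (a : nat -> nat -> R[i]) (b : nat -> nat -> R) B r c s :
  (forall m n, normc (a m n) <= b m n) ->
  (forall m, sums_to (b m) (B m)) -> cvgn (series B) ->
  (forall m, csums_to (a m) (r m)) -> csums_to r s ->
  (forall n, csums_to (a ^~ n) (c n)) -> csums_to c s.
Proof.
move=> ab hb hB ha [r1 r2] hc; split.
  apply: (@sums_to_swap _ (fun m n => complex.Re (a m n)) b B _ _ _ _ hb hB) r1 _.
  - by move=> m n; apply: le_trans (ab m n); exact: Re_le_normc.
  - by move=> m; case: (ha m).
  - by move=> m; case: (hc m).
apply: (@sums_to_swap _ (fun m n => complex.Im (a m n)) b B _ _ _ _ hb hB) r2 _.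
- by move=> m n; apply: le_trans (ab m n); exact: Im_le_normc.
- by move=> m; case: (ha m).
- by move=> m; case: (hc m).
Qed.

Lemma normc_real (e : R) : normc e%:C = `|e|.
Proof. by rewrite /= expr0n/= addr0 sqrtr_sqr. Qed.

Lemma normcX_le1 (u : R[i]) n : normc u <= 1 -> normc (u ^+ n) <= 1.
Proof. by move=> u1; rewrite normcX exprn_ile1// normc_ge0. Qed.

End ComplexSeries.

(** * Convolution powers, their generating functions and mixtures *)

Section ConvPower.
Context {R : realType}.
Variable y : nat -> R.
Hypothesis y_ge0 : forall n, 0 <= y n.
Hypothesis y_sum : sums_to y 1.

Lemma conv_power_ge0 k n : 0 <= conv_power y k n.
Proof.
by elim: k n => [|k ih] n /=; rewrite ?ler0n// sumr_ge0// => i _; rewrite mulr_ge0.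
Qed.

(** The Cauchy product as a double series: row i sums to [conv_power y k i] and column n to
    [conv_power y k.+1 n]. *)
Let table k (i n : nat) : R :=
  if (i <= n)%N then conv_power y k i * y (n - i)%N else 0.

Let table_ge0 k i n : 0 <= table k i n.
Proof. by rewrite /table; case: ifP => // _; rewrite mulr_ge0// conv_power_ge0. Qed.

Let table_row k i : sums_to (table k i) (conv_power y k i).
Proof.
rewrite -[conv_power y k i]mulr1.
apply: (eq_sums_to (@sums_toZ _ _ _ (conv_power y k i) (sums_to_shift i y_sum))) => n.
by rewrite /table; case: ifP => //; rewrite mulr0.
Qed.

Let table_col k n : sums_to (table k ^~ n) (conv_power y k.+1 n).
Proof.
rewrite /= (eq_bigr (fun i : 'I_n.+1 => table k i n)).
  by apply: sums_to_finite => m; rewrite /table ltnNge => /negbTE ->.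
by move=> i _; rewrite /table -ltnS ltn_ord.
Qed.

Lemma conv_power_sum k : sums_to (conv_power y k) 1.
Proof.
elim: k => [|k ih].
  rewrite [X in sums_to _ X](_ : _ = \sum_(i < 1) conv_power y 0 i).
    by apply: sums_to_finite => -[].
  by rewrite big_ord1.
exact: (@sums_to_swap_ge0 _ (table k) (conv_power y k) _ _ (table_ge0 k)
  (@table_row k) ih (@table_col k)).
Qed.

(** Convolution becomes multiplication: the Cauchy product table times u^n is dominated by the table
    itself, since |u| <= 1. *)
Lemma conv_power_gen_fun (u g : R[i]) k : normc u <= 1 ->
  csums_to (fun n => (y n)%:C * u ^+ n) g ->
  csums_to (fun n => (conv_power y k n)%:C * u ^+ n) (g ^+ k).
Proof.
move=> u1 hg; elim: k => [|k ih].
  rewrite [X in csums_to _ X](_ : _ = \sum_(i < 1) (conv_power y 0 i)%:C * u ^+ i).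
    by apply: csums_to_finite => -[//|n] _ /=; rewrite mul0r.
  by rewrite big_ord1 /= mul1r !expr0.
have hB : cvgn (series (conv_power y k)) by exact: cvgP (conv_power_sum k).
apply: (@csums_to_swap _ (fun i n => (table k i n)%:C * u ^+ n) (table k)
   (conv_power y k) (fun i => g * ((conv_power y k i)%:C * u ^+ i))) => //.
- move=> i n; rewrite normcM normc_real ger0_norm//.
  by rewrite ler_piMr// normcX_le1.
- move=> i; rewrite mulrC.
  apply: (eq_csums_to (csums_toZ _ (csums_to_shift i hg))) => n.
  rewrite /table; case: ifP => [i_n|_]; last by rewrite mulr0 mul0r.
  have -> : u ^+ n = u ^+ (n - i) * u ^+ i by rewrite -exprD subnK.
  by rewrite rmorphM; ring.
- by rewrite exprS; exact: csums_toZ.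
- move=> n /=; rewrite rmorph_sum mulr_suml.
  rewrite (eq_bigr (fun i : 'I_n.+1 => (table k i n)%:C * u ^+ n)).
    by apply: csums_to_finite => m; rewrite /table ltnNge => /negbTE ->; rewrite mul0r.
  by move=> i _; rewrite /table -ltnS ltn_ord.
Qed.

(** The weights w times a probability law form a summable majorant. The shift j serves both uses: j
    = 0 gives the coefficients of [phibar], j = 1 the law of Z. *)
Lemma mixture_gen_fun (w : nat -> R) (u g s : R[i]) (j : nat) (c : nat -> R) :
  normc u <= 1 -> (forall k, 0 <= w k) -> cvgn (series w) ->
  csums_to (fun n => (y n)%:C * u ^+ n) g ->
  csums_to (fun k => (w k)%:C * g ^+ (k + j)) s ->
  (forall n, sums_to (fun k => w k * conv_power y (k + j) n) (c n)) ->
  csums_to (fun n => (c n)%:C * u ^+ n) s.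
Proof.
move=> u1 w0 hw hg hs hc.
apply: (@csums_to_swap _ (fun k n => (w k * conv_power y (k + j) n)%:C * u ^+ n)
  (fun k n => w k * conv_power y (k + j) n) w _ _ _ _ _ hw _ hs).
- move=> k n; have h : 0 <= w k * conv_power y (k + j) n.
    by rewrite mulr_ge0// conv_power_ge0.
  by rewrite normcM normc_real ger0_norm// ler_piMr// normcX_le1.
- move=> k; rewrite -[w k in X in sums_to _ X]mulr1.
  exact: sums_toZ (conv_power_sum _).
- move=> k.
  apply: (eq_csums_to (csums_toZ _ (conv_power_gen_fun (k + j) u1 hg))) => n.
  by rewrite rmorphM mulrA.
- move=> n; rewrite mulrC.
  have H : csums_to (fun k => (w k * conv_power y (k + j) n)%:C) (c n)%:C.
    exact: csums_to_real.
  by apply: (eq_csums_to (csums_toZ _ H)) => k; rewrite mulrC.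
Qed.

                                                                                
(** Multiplying the series by the conjugate of g and taking real parts gives |g|^2 <= |g| * sum_n y
    n = |g|. This places q g inside the unit disc. *)
Lemma gen_fun_normc_le1 (u g : R[i]) : normc u <= 1 ->
  csums_to (fun n => (y n)%:C * u ^+ n) g -> normc g <= 1.
Proof.
move=> u1 hg.
have [h _] := csums_toZ g^*%C hg.
have : 0 <= normc g * 1 - complex.Re (g^*%C * g).
  apply: sums_to_ge0 (sums_toB (@sums_toZ _ _ _ (normc g) y_sum) h) => n.
  have : `|complex.Re (g^*%C * ((y n)%:C * u ^+ n))| <= normc g * y n.
    apply: le_trans (Re_le_normc _) _.
    rewrite !normcM normc_real ger0_norm//.
    have -> : normc g^*%C = normc g by case: (g) => a b /=; rewrite sqrrN.
    by rewrite mulrA ler_piMr ?mulr_ge0 ?normc_ge0// normcX_le1.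
  by rewrite ler_norml => /andP[]; lra.
have -> : complex.Re (g^*%C * g) = normc g ^+ 2.
  by rewrite sqr_normc; case: (g) => a b /=; ring.
have := normc_ge0 g; rewrite mulr1 => g0 hh; rewrite leNgt; apply/negP => g1.
by nra.
Qed.

End ConvPower.

                                    

(** * Events described by partial sums *)

Lemma sigma_algebraI {T : Type} (M : set (set T)) : sigma_algebra setT M ->
  forall A B, M A -> M B -> M (A `&` B).
Proof.
move=> [_ MC MU] A B MA MB.
have -> : A `&` B = setT `\` \bigcup_(k : nat) (setT `\` (if k is 0%N then A else B)).
  apply/seteqP; split=> [w [Aw Bw]|w [_ h]].
    by split=> // -[[|k] _ [_]].
  split; apply: contrapT => h'; apply: h.
    by exists 0%N.
  by exists 1%N.
by apply: (MC); apply: (MU) => -[|k]; exact: (MC).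
Qed.

Section PartialSums.
Context {T : Type}.
Variable Y : nat -> T -> nat.

Definition partial_sum (k : nat) (w : T) : nat := (\sum_(j < k) Y j w)%N.

Lemma partial_sumS k n : partial_sum k.+1 @^-1` [set n] =
  \bigcup_i (partial_sum k @^-1` [set i] `&` Y k @^-1` [set j | (i + j)%N = n]).
Proof.
apply/seteqP; split=> [w h|w [i _ [/= <-]]]; rewrite /partial_sum/= ?big_ord_recr//.
by exists (partial_sum k w) => //; split=> //=; rewrite -h /= /partial_sum big_ord_recr.
Qed.

(** The family M is left general: it is taken to be the measurable sets, and also the sigma-algebra
    generated by the sequence, where independence from N applies. *)
Lemma sigma_algebra_partial_sum (M : set (set T)) k n : sigma_algebra setT M ->
  (forall i A, M (Y i @^-1` A)) -> M (partial_sum k @^-1` [set n]).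
Proof.
move=> sM MY; elim: k n => [|k ih] n.
  have [M0 MC _] := sM; case: n => [|n].
    rewrite [X in M X](_ : _ = setT `\` set0); first exact: MC.
    by apply/seteqP; split=> w _; [split|rewrite /= /partial_sum big_ord0].
  rewrite [X in M X](_ : _ = set0)//.
  by apply/seteqP; split=> w //; rewrite /= /partial_sum big_ord0.
rewrite partial_sumS; case: (sM) => _ _; apply=> i.
exact: sigma_algebraI.
Qed.

End PartialSums.

(** * Expectations as series, and the law of the random sum *)

Section RandomSumPmf.
Context {d : measure_display} {T : measurableType d} {R : realType}.
Variable P : probability T R.
Implicit Types A B : set T.

Let pr A : R := fine (P A).

Let prK A : measurable A -> (pr A)%:E = P A.
Proof. by move=> mA; rewrite fineK// fin_num_measure. Qed.

Let pr_ge0 A : 0 <= pr A.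
Proof. by rewrite fine_ge0. Qed.

Lemma measurable_nat (A : set nat) : measurable A.
Proof. by []. Qed.

Lemma sums_to_pr_bigcup (F : nat -> set T) : (forall n, measurable (F n)) ->
  trivIset setT F -> sums_to (fun n => pr (F n)) (pr (\bigcup_n F n)).
Proof.
move=> mF tF; apply/sums_to_nneseries => //.
have mU : measurable (\bigcup_n F n) by exact: bigcup_measurable.
rewrite prK// measure_semi_bigcup//.
by apply: eq_eseriesr => n _; rewrite prK.
Qed.

Lemma trivIset_preimage (S : Type) (X : S -> nat) :
  trivIset setT (fun n => X @^-1` [set n]).
Proof. by move=> i j _ _ [w [/= <- <-]]. Qed.

Lemma bigcup_preimage (S : Type) (X : S -> nat) :
  \bigcup_n (X @^-1` [set n]) = setT.
Proof. by apply/seteqP; split=> // w _; exists (X w). Qed.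

Lemma pmf_sum (X : T -> nat) : (forall n, measurable (X @^-1` [set n])) ->
  sums_to (fun n => pr (X @^-1` [set n])) 1.
Proof.
move=> mX; have := sums_to_pr_bigcup mX (@trivIset_preimage _ X).
by rewrite bigcup_preimage /pr probability_setT.
Qed.

(** The integral splits over the level sets of X, on each of which the integrand is constant;
    boundedness makes it integrable. *)
Lemma expectation_bounded_sum (X : T -> nat) (f : nat -> R) (K : R) :
  (forall n, measurable (X @^-1` [set n])) -> (forall n, `|f n| <= K) ->
  sums_to (fun n => f n * pr (X @^-1` [set n])) (fine ('E_P[fun w => f (X w)])).
Proof.
move=> mX fK.
have hs := pmf_sum mX.
have [s hs'] : exists s, sums_to (fun n => f n * pr (X @^-1` [set n])) s.
  apply: (@dominated_sums_to _ _ (fun n => K * pr (X @^-1` [set n]))).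
    by move=> n; rewrite normrM (ger0_norm (pr_ge0 _)) ler_wpM2r.
  exact: cvgP (@sums_toZ _ _ _ K hs).
suff : ('E_P[fun w => f (X w)] = s%:E)%E by move=> ->.
have mf : measurable_fun setT (fun w => f (X w)).
  move=> _ B mB; rewrite setTI.
  rewrite [X in measurable X](_ : _ = \bigcup_(n in f @^-1` B) (X @^-1` [set n])).
    by apply: bigcup_measurable.
  apply/seteqP; split=> [w Bw|w [n /= fn Xw]]; last by rewrite /= Xw.
  by exists (X w).
rewrite unlock -(bigcup_preimage X) integral_bigcup//.
- have h n : (\int[P]_(x in X @^-1` [set n]) (f (X x))%:E)%E =
    (f n * pr (X @^-1` [set n]))%:E.
    rewrite (eq_integral (cst (f n)%:E)).
      by rewrite integral_cst// EFinM prK.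
    by move=> w; rewrite inE => /= ->.
  under eq_eseriesr do rewrite h.
  apply: cvg_lim => //.
  rewrite (_ : (fun n => _) = EFin \o series (fun n => f n * pr (X @^-1` [set n]))).
    exact: cvg_EFin (nearW _ _) hs'.
  by apply/funext => n; rewrite /series/= sumEFin.
- exact: trivIset_preimage.
- rewrite bigcup_preimage; apply: measurable_bounded_integrable => //.
    by rewrite -ge0_fin_numE// fin_num_measure.
  exists K; split; first exact: num_real.
  by move=> M KM w _ /=; apply: le_trans (ltW KM).
Qed.

Lemma gen_fun_csums_to (X : T -> nat) (u : R[i]) :
  (forall n, measurable (X @^-1` [set n])) -> normc u <= 1 ->
  csums_to (fun n => (pr (X @^-1` [set n]))%:C * u ^+ n) (gen_fun P X u).
Proof.
move=> mX u1; split => /=.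
  apply: (eq_sums_to (@expectation_bounded_sum X (fun n => complex.Re (u ^+ n)) 1 mX _)).
    by move=> n; apply: le_trans (Re_le_normc _) _; exact: normcX_le1.
  by move=> n; rewrite cReM/= mul0r subr0 mulrC.
apply: (eq_sums_to (@expectation_bounded_sum X (fun n => complex.Im (u ^+ n)) 1 mX _)).
  by move=> n; apply: le_trans (Im_le_normc _) _; exact: normcX_le1.
by move=> n; rewrite cImM/= mul0r addr0 mulrC.
Qed.

Variable Y : nat -> {RV P >-> nat}.
Hypothesis Y_indep : mutually_independent P Y.
Hypothesis Y_id : identically_distributed P Y.

Let y n := pr (Y 0%N @^-1` [set n]).

Lemma measurable_RV_preimage (X : {RV P >-> nat}) (A : set nat) :
  measurable (X @^-1` A).
Proof. by rewrite -[_ @^-1` _]setTI; exact: measurable_funP. Qed.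

Lemma measurable_partial_sum k n : measurable (partial_sum Y k @^-1` [set n]).
Proof.
apply: sigma_algebra_partial_sum => [|i A]; last exact: measurable_RV_preimage.
exact: sigma_algebra_measurable.
Qed.

                                                                                 
                                                   
Let tail k l (A : nat -> set nat) : set T :=
  \bigcap_(i in `I_l) (Y (k + i)%N @^-1` A i).

Let measurable_tail k l (A : nat -> set nat) : measurable (tail k l A).
Proof. by apply: fin_bigcap_measurable => // i _; exact: measurable_RV_preimage. Qed.

Let tail0 l (A : nat -> set nat) :
  P (tail 0 l A) = (\prod_(i < l) pr (Y i @^-1` A i))%:E.
Proof.
have := Y_indep [fset x | x in iota 0 l]%fset (fun i => measurable_nat (A i)).
rewrite (_ : \bigcap_(i in _) _ = tail 0 l A).
  move=> ->.
  rewrite (perm_big (iota 0 l)).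
    rewrite -[l in iota 0 l]subn0 -/(index_iota 0 l) big_mkord -prodEFin.
    by apply: eq_bigr => i _; rewrite prK//; exact: measurable_RV_preimage.
  apply: uniq_perm; rewrite ?fset_uniq ?iota_uniq// => i.
  by rewrite !inE.
rewrite /tail (_ : [set` _] = `I_l)//; apply/seteqP; split=> i /=; rewrite !inE mem_iota//=.
Qed.

(** Mutual independence speaks of events of single variables only, so the claim is strengthened by l
    conditions on the variables following the partial sum. The induction step moves one variable out
    of the partial sum into this tail, until no partial sum is left. *)
Lemma partial_sum_tail k l n (A : nat -> set nat) :
  P (partial_sum Y k @^-1` [set n] `&` tail k l A) =
  (conv_power y k n * \prod_(i < l) pr (Y (k + i)%N @^-1` A i))%:E.
Proof.
elim: k l n A => [|k ih] l n A.
  case: n => [|n] /=.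
    rewrite [X in X `&` _](_ : _ = setT) ?setTI ?tail0 ?mul1r//.
    by apply/seteqP; split=> w // _; rewrite /= /partial_sum big_ord0.
  rewrite [X in X `&` _](_ : _ = set0) ?set0I ?measure0 ?mul0r//.
  by apply/seteqP; split=> w //; rewrite /= /partial_sum big_ord0.
(* If the first k variables sum to i, then the next one must equal n - i; this becomes the first
   condition of the longer tail. *)
pose A' (i j : nat) := if j is j'.+1 then A j' else [set (n - i)%N].
pose F (i : nat) := partial_sum Y k @^-1` [set i] `&` tail k l.+1 (A' i).
have FE : partial_sum Y k.+1 @^-1` [set n] `&` tail k.+1 l A =
    \big[setU/set0]_(i < n.+1) F i.
  rewrite -bigcup_mkord; apply/seteqP; split=> [w [hn ht]|w [i /= i_n [hi ht]]].
    have hn' : (partial_sum Y k w + Y k w)%N = n.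
      by move: hn; rewrite /= /partial_sum big_ord_recr.
    have kn : (partial_sum Y k w < n.+1)%N by rewrite ltnS -hn' leq_addr.
    exists (partial_sum Y k w) => //; split=> // -[_|j jl] /=.
      by rewrite addn0 -hn' addKn.
    by rewrite addnS -addSn; exact: ht.
  split.
    have := ht 0%N isT; rewrite /= addn0 => h0.
    by rewrite /partial_sum/= big_ord_recr/= -/(partial_sum Y k w) hi h0 subnKC.
  by move=> j jl; have := ht j.+1 jl; rewrite /= addnS -addSn.
rewrite FE measure_bigsetU_ord.
- transitivity (\sum_(i < n.+1) (conv_power y k i *
    (y (n - i)%N * \prod_(i < l) pr (Y (k.+1 + i)%N @^-1` A i)))%:E)%E.
    apply: eq_bigr => i _; apply: etrans (ih _ _ _) _; rewrite big_ord_recl/= addn0.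
    congr (_ * (_ * _))%:E.
      by rewrite /y /pr (Y_id k 0%N).
    by apply: eq_bigr => j _; rewrite /bump/= add1n addnS -addSn.
  rewrite sumEFin; congr EFin; rewrite mulr_suml; apply: eq_bigr => i _.
  by rewrite mulrA.
- by move=> i; apply: measurableI => //; exact: measurable_partial_sum.
- move=> i j _ _ [w [[/= hi _] [/= hj _]]]; apply: val_inj => /=.
  by rewrite -hi -hj.
Qed.

Lemma pmf_partial_sum k n : P (partial_sum Y k @^-1` [set n]) = (conv_power y k n)%:E.
Proof.
have := partial_sum_tail k 0 n (fun=> setT).
by rewrite /tail II0 bigcap_set0 setIT big_ord0 mulr1.
Qed.

Variable N : {RV P >-> nat}.
Hypothesis NY_indep : independent_of_seq P N Y.

Let random_sum_bigcup n : random_sum N Y @^-1` [set n] =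
  \bigcup_k (N @^-1` [set k] `&` partial_sum Y k @^-1` [set n]).
Proof.
apply/seteqP; split=> [w h|w [k _ [/= <-]]//].
by exists (N w).
Qed.

Lemma measurable_random_sum n : measurable (random_sum N Y @^-1` [set n]).
Proof.
rewrite random_sum_bigcup; apply: bigcup_measurable => k _; apply: measurableI.
  exact: measurable_RV_preimage.
exact: measurable_partial_sum.
Qed.

Lemma pmf_random_sum n :
  sums_to (fun k => pr (N @^-1` [set k]) * conv_power y k n)
    (pr (random_sum N Y @^-1` [set n])).
Proof.
rewrite random_sum_bigcup.
have mF k : measurable (N @^-1` [set k] `&` partial_sum Y k @^-1` [set n]).
  apply: measurableI; first exact: measurable_RV_preimage.
  exact: measurable_partial_sum.
apply: (eq_sums_to (sums_to_pr_bigcup mF _)).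
  by move=> i j _ _ [w [[/= <- _] [/= <- _]]].
move=> k /=; rewrite /pr NY_indep//.
  rewrite pmf_partial_sum fineM//; last exact: fin_num_measure (measurable_RV_preimage _ _).
apply: sigma_algebra_partial_sum.
  exact: smallest_sigma_algebra.
by move=> i A; apply: sub_gen_smallest; exists i, A.
Qed.

End RandomSumPmf.

(** * Convergence in [R[i]] and by components *)

Section ComplexConvergence.
Context {R : realType}.

Lemma cvg_complexP (f : nat -> R[i]) (l : R[i]) :
  (f : nat -> R[i]^o) @ \oo --> (l : R[i]^o) <->
  (fun n => complex.Re (f n)) @ \oo --> complex.Re l /\
  (fun n => complex.Im (f n)) @ \oo --> complex.Im l.
Proof.
split=> [h|[h1 h2]].
- have h' (e : R) : 0 < e -> \forall n \near \oo, normc (l - f n) < e.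
    move=> e0; have eC : 0 < e%:C by rewrite ltcR.
    move/cvgrPdist_lt : h => /(_ _ eC); apply: filterS => n.
    by rewrite normC_real ltcR.
  split; apply/cvgrPdist_lt => e /h'; apply: filterS => n; apply: le_lt_trans.
    by rewrite -cReB; exact: Re_le_normc.
  by rewrite -cImB; exact: Im_le_normc.
(* A positive element of [R[i]] has imaginary part 0, so the radius is a real number e. *)
- apply/cvgrPdist_lt => -[e e'] /[dup]; rewrite {1}ltcE/= => /andP[/eqP -> e0] _.
  have e2 : 0 < e / 2 by lra.
  move/cvgrPdist_lt : h1 => /(_ _ e2) h1; move/cvgrPdist_lt : h2 => /(_ _ e2) h2.
  near=> n.
  rewrite normC_real ltcR.
  have a1 : `|complex.Re l - complex.Re (f n)| < e / 2 by near: n.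
  have a2 : `|complex.Im l - complex.Im (f n)| < e / 2 by near: n.
  rewrite -cReB in a1; rewrite -cImB in a2; move: a1 a2.
  set z := l - f n => a1 a2.
  rewrite -(@ltr_pXn2r _ 2)// ?nnegrE ?normc_ge0 ?(ltW e0)// sqr_normc.
  rewrite -(real_normK (num_real (complex.Re z))) -(real_normK (num_real (complex.Im z))).
  have := normr_ge0 (complex.Re z); have := normr_ge0 (complex.Im z).
  by nra.
Unshelve. all: by end_near. Qed.

Lemma csums_toP (a : nat -> R[i]) (s : R[i]) :
  series (a : nat -> R[i]^o) @ \oo --> (s : R[i]^o) <-> csums_to a s.
Proof.
rewrite (cvg_complexP (series (a : nat -> R[i]^o))) /csums_to /sums_to.
rewrite (_ : (fun n => complex.Re _) = series (fun n => complex.Re (a n))).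
  rewrite (_ : (fun n => complex.Im _) = series (fun n => complex.Im (a n)))//.
  by apply/funext => n; rewrite /series/= Im_sum.
by apply/funext => n; rewrite /series/= Re_sum.
Qed.

End ComplexConvergence.

                                                      

(** * Absolutely convergent sums and bounds for real powers *)

Section AbsSums.
Context {R : realType}.
Implicit Types (a b : nat -> R) (s t x : R).

Lemma eq_abs_sums_to a b s : abs_sums_to a s -> a =1 b -> abs_sums_to b s.
Proof. by move=> + /funext <-. Qed.

Lemma abs_sums_toZ a s x : abs_sums_to a s -> abs_sums_to (fun n => x * a n) (x * s).
Proof.
move=> [h1 h2]; split; last exact: sums_toZ.
have /cvg_ex[l hl] := h1.
apply: (cvgP (`|x| * l)); apply: (eq_sums_to (@sums_toZ _ _ _ `|x| hl)) => n.
by rewrite /= normrM.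
Qed.

Lemma abs_sums_toB a b s t : abs_sums_to a s -> abs_sums_to b t ->
  abs_sums_to (fun n => a n - b n) (s - t).
Proof.
move=> [a1 a2] [b1 b2]; split; last exact: sums_toB.
move: a1 b1 => /cvg_ex[la hla] /cvg_ex[lb hlb].
apply: (@dominated_cvg_series _ _ (fun n => `|a n| + `|b n|)).
  by move=> n; exact: ler_normB.
exact: cvgP (sums_toD hla hlb).
Qed.

End AbsSums.

Section PowerFunction.
Context {R : realType}.
Implicit Types (x y alpha : R).

Lemma powRD_gt0 x (r s : R) : 0 < x -> x `^ (r + s) = x `^ r * x `^ s.
Proof. by move=> x0; rewrite powRD//; apply/implyP => _; rewrite gt_eqF. Qed.

(** For alpha in ]0, 1] the power x^alpha lies between x and 1, so it exceeds whatever is below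
    both; the next lemma is the mirror image. *)
Lemma lt_powR_root x y alpha : 0 < alpha <= 1 -> 0 < x -> y < x -> y < 1 ->
  y < x `^ alpha.
Proof.
move=> /andP[a0 a1] x0 yx y1; have [x1|x1] := leP 1 x.
  by rewrite (lt_le_trans y1)// -[leLHS](powRr0 x) ler_powR// ltW.
by apply: lt_le_trans yx _; rewrite ger1_powR// x0 ltW.
Qed.

Lemma powR_root_lt x y alpha : 0 < alpha <= 1 -> 0 < x -> x < y -> 1 < y ->
  x `^ alpha < y.
Proof.
move=> /andP[a0 a1] x0 xy y1; have [x1|x1] := leP 1 x.
  by apply: le_lt_trans xy; rewrite ler1_powR.
by apply: le_lt_trans y1; rewrite -[leRHS](powRr0 x) ger_powR ?x0 ?ltW.
Qed.

End PowerFunction.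

(** * Coefficients read off from a double series *)

Section CoefficientSeries.
Context {R : realType}.
Variables (alpha nu y K r : R) (c G : nat -> R).
Hypothesis alpha01 : 0 < alpha <= 1.
Hypothesis y01 : 0 < y < 1.
Hypothesis c_le : forall m, `|c m| <= alpha * (m%:R + K).
Hypothesis r_gt0 : 0 < r.
Let b m : R := binom_coef nu m * (- y) ^+ m.
Hypothesis G_sums : forall u : R, `|u| < r ->
  exists2 s, sums_to (fun t => G t * u ^+ t) s
           & sums_to (fun m => b m * (1 - u) `^ (- c m)) s.

Let entry (u : R) m t : R := b m * (binom_coef (c m) t * u ^+ t).
Let bound (u : R) m t : R :=
  `|b m| * (binom_coef (alpha * (m%:R + K)) t * `|u| ^+ t).
Let bound_sum (u : R) m : R := `|b m| * (1 - `|u|) `^ (- (alpha * (m%:R + K))).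

Let entry_le u m t : `|entry u m t| <= bound u m t.
Proof.
rewrite /entry /bound normrM ler_wpM2l// normrM normrX ler_wpM2r ?exprn_ge0//.
exact: binom_coef_le.
Qed.

Let u_lt1 (u : R) : `|u| < 1 - y -> `|u| < 1.
Proof. by have /andP[] := y01; lra. Qed.

Let bound_row u m : `|u| < 1 - y -> sums_to (bound u m) (bound_sum u m).
Proof. by move=> /u_lt1 u1; apply/sums_toZ/real_binomial_series; rewrite normr_id. Qed.

(** With v = (1 - |u|)^alpha the row sums of the majorant are v^(-K) |binom_coef nu m| (y / v)^m,
    and y < 1 - |u| <= v. *)
Let bound_sum_cvg u : `|u| < 1 - y -> cvgn (series (bound_sum u)).
Proof.
move=> uy; have u1 := u_lt1 uy; have /andP[y0 y1] := y01.
set v := (1 - `|u|) `^ alpha.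
have yv : y < v by apply: lt_powR_root => //; lra.
have v0 : 0 < v by lra.
have yv1 : `|y / v| < 1 by rewrite ger0_norm ?divr_ge0 ?ltW// ltr_pdivrMr// mul1r.
have /cvg_ex[l hl] := @cvg_binom_coef _ nu _ yv1.
apply: (cvgP (v `^ (- K) * l)).
apply: (eq_sums_to (@sums_toZ _ _ _ (v `^ (- K)) hl)) => m.
rewrite /bound_sum -mulrN powRrM -/v opprD addrC powRD_gt0// powR_invn ?ltW//.
rewrite /b (normrM (binom_coef nu m)) (normrX m (- y)) normrN (gtr0_norm y0).
rewrite (ger0_norm (_ : 0 <= y / v)) ?divr_ge0 ?ltW//.
by rewrite exprMn exprVn; ring.
Qed.

(** Expanding each (1 - u)^(- c m) by the binomial series gives a dominated double series; its
    columns are power series terms, which uniqueness identifies with those of G. *)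
Lemma coefficient_series t :
  abs_sums_to (fun m => b m * pochhammer (c m) t) (G t * t`!%:R).
Proof.
have /andP[y0 y1] := y01.
have ft (k : nat) : k`!%:R != 0 :> R by rewrite pnatr_eq0 -lt0n fact_gt0.
have H k : cvgn [normed series (fun m => b m * binom_coef (c m) k)].
  (* Any nonzero point of the domain of domination would do: absolute convergence of column k there,
     divided by u^k, is that of the coefficient series. *)
  pose u : R := (1 - y) / 2.
  have u0 : 0 < u by rewrite /u; lra.
  have uy : `|u| < 1 - y by rewrite ger0_norm /u; lra.
  have /cvg_ex[l hl] := @dominated_column _ _ _ _ k (entry_le u)
    (fun m => @bound_row u m uy) (bound_sum_cvg uy).
  apply: (cvgP (u ^- k * l)); apply: (eq_sums_to (@sums_toZ _ _ _ (u ^- k) hl)) => m.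
  rewrite /entry /= mulrA normrM (ger0_norm (_ : 0 <= u ^+ k)) ?exprn_ge0 ?ltW//.
  by rewrite mulrC mulfK// expf_neq0 ?gt_eqF.
have /choice[C hC] : forall k, exists x, sums_to (fun m => b m * binom_coef (c m) k) x.
  by move=> k; exists (limn (series (fun m => b m * binom_coef (c m) k))); exact: normed_cvg (H k).
have GC : G = C.
  apply: (@power_series_unique _ (Num.min r (1 - y))).
    by rewrite lt_min r_gt0/=; lra.
  move=> u; rewrite lt_min => /andP[ur uy].
  have [s hG hs] := G_sums ur; exists s => //.
  apply: (@sums_to_swap _ (entry u) (bound u) _ _ _ _ (entry_le u)
    (fun m => @bound_row u m uy) (bound_sum_cvg uy)) hs _.
    by move=> m; apply/sums_toZ/real_binomial_series; exact: u_lt1.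
  move=> k; apply: (eq_sums_to (@sums_toZr _ _ _ (u ^+ k) (hC k))) => m.
  by rewrite /entry mulrA.
have hk : abs_sums_to (fun m => b m * binom_coef (c m) t) (G t).
  by split; [exact: H | rewrite GC; exact: hC].
rewrite mulrC; apply: (eq_abs_sums_to (abs_sums_toZ t`!%:R hk)) => m.
by rewrite mulrCA; congr (_ * _); rewrite /binom_coef mulrC divfK.
Qed.

End CoefficientSeries.

(** * Expansions of [phibar] *)

Section Expansions.
Context {R : realType}.
Variables (alpha nu xi : R).
Hypothesis alpha01 : 0 < alpha <= 1.
Hypothesis xi_gt0 : 0 < xi.
Implicit Type u a : R.

(** Here xi < v, and v^(-a) (1 + xi / v)^(-nu) = v^(nu - a) (xi + v)^(-nu). Choosing a = nu yields
    [phibar] and a = nu - 1 yields v times it, up to the factor xi^nu. *)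
Lemma small_xi_expansion u a : `|u| < 1 - xi ->
  let v := (1 - u) `^ alpha in
  sums_to (fun m => binom_coef nu m * (- xi) ^+ m * (1 - u) `^ (- (alpha * (m%:R + a))))
    (v `^ (nu - a) * (xi + v) `^ (- nu)).
Proof.
move=> ux v; have := ler_norm u => uu; have := normr_ge0 u => u0; have xi0 := xi_gt0.
have xv : xi < v by apply: lt_powR_root => //; lra.
have v0 : 0 < v by lra.
have hz : `|- (xi / v)| < 1.
  by rewrite normrN ger0_norm ?divr_ge0 ?ltW// ltr_pdivrMr// mul1r.
have := @sums_toZ _ _ _ (v `^ (- a)) (@real_binomial_series _ nu _ hz).
have -> : xi + v = v * (1 - - (xi / v)) by field; rewrite gt_eqF.
have w0 : 0 <= 1 - - (xi / v) by rewrite opprK addr_ge0// divr_ge0// ltW.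
rewrite powRM ?(ltW v0)// mulrA -powRD_gt0// [nu - a + _](_ : _ = - a); last ring.
move=> /eq_sums_to; apply => m.
rewrite -(mulrN alpha) powRrM -/v opprD addrC powRD_gt0// powR_invn ?ltW//.
by rewrite -mulNr exprMn exprVn; ring.
Qed.

(** Here v < xi, and the series is that of v^a (1 + v / xi)^(-nu); a = 0 and a = 1 are the two cases
    of use. *)
Lemma large_xi_expansion u a : 1 < xi -> `|u| < 1 -> `|u| < xi - 1 ->
  let v := (1 - u) `^ alpha in
  sums_to (fun m => binom_coef nu m * (- xi^-1) ^+ m * (1 - u) `^ (alpha * (m%:R + a)))
    (v `^ a * (xi `^ nu * (xi + v) `^ (- nu))).
Proof.
move=> x1 u1 ux v; have := ler_norm u => uu; have := normr_ge0 u => u0; have xi0 := xi_gt0.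
have := ler_norm (- u); rewrite normrN => Nuu.
have vx : v < xi by apply: powR_root_lt => //; lra.
have v0 : 0 < v by rewrite powR_gt0//; lra.
have hz : `|- (v / xi)| < 1.
  by rewrite normrN ger0_norm ?divr_ge0 ?ltW// ltr_pdivrMr// mul1r.
have := @sums_toZ _ _ _ (v `^ a) (@real_binomial_series _ nu _ hz).
have -> : xi + v = xi * (1 - - (v / xi)) by field; rewrite gt_eqF.
have w0 : 0 <= 1 - - (v / xi) by rewrite opprK addr_ge0// divr_ge0// ltW.
rewrite (powRM _ (ltW xi_gt0) w0) [xi `^ nu * _]mulrA -powRD_gt0// subrr powRr0 mul1r.
move=> /eq_sums_to; apply => m.
rewrite powRrM -/v addrC powRD_gt0// powR_mulrn ?ltW//.
by rewrite -mulrN mulrC exprMn; ring.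
Qed.

End Expansions.

Section Phibar.
Context {R : realType}.
Variables (alpha nu xi : R).

Definition phibar_real (u : R) : R :=
  xi `^ nu * (xi + (1 - u) `^ alpha) `^ (- nu).

Lemma cpow_one_minus_real (u : R) : `|u| < 1 ->
  cpow (1 - u%:C) alpha = ((1 - u) `^ alpha)%:C.
Proof.
move=> u1; have := ler_norm u => uu.
by rewrite -(rmorph1 (real_complex R)) -rmorphB cpow_gt0//; lra.
Qed.

Lemma phibar_realE (u : R) : 0 < xi -> `|u| < 1 ->
  phibar alpha nu xi u%:C = (phibar_real u)%:C.
Proof.
move=> xi0 u1; have := ler_norm u => uu.
have v0 : 0 < (1 - u) `^ alpha by rewrite powR_gt0//; lra.
rewrite /phibar cpow_one_minus_real// -rmorphD cpow_gt0; last lra.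
by rewrite -fmorphV -rmorphM -powRN.
Qed.

Hypothesis alpha01 : 0 < alpha <= 1.

Lemma small_xi_coefficients (a : R) (G : nat -> R) : 0 < xi < 1 ->
  (forall u : R, `|u| < 1 -> sums_to (fun t => G t * u ^+ t)
    (((1 - u) `^ alpha) `^ (nu - a) * phibar_real u)) ->
  forall t, abs_sums_to (fun m : nat =>
      (-1) ^+ m * pochhammer nu m * xi ^+ m / m`!%:R
      * pochhammer (alpha * (m%:R + a)) t)
    (G t / xi `^ nu * t`!%:R).
Proof.
move=> xi01 hG t; have /andP[xi0 xi1] := xi01; have /andP[al0 _] := alpha01.
have xn : xi `^ nu != 0 by rewrite gt_eqF// powR_gt0.
have c_le m : `|alpha * (m%:R + a)| <= alpha * (m%:R + `|a|).
  rewrite normrM (gtr0_norm al0) ler_pM2l//.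
  by apply: le_trans (ler_normD _ _) _; rewrite normr_nat.
have r0 : 0 < 1 - xi by lra.
have := @coefficient_series _ alpha nu xi `|a| (1 - xi)
  (fun m => alpha * (m%:R + a)) (fun t => G t / xi `^ nu) alpha01 xi01 c_le r0.
move=> /(_ _ t) h; apply: eq_abs_sums_to (h _) _ => [u ur|m].
  exists (((1 - u) `^ alpha) `^ (nu - a) * (xi + (1 - u) `^ alpha) `^ (- nu)).
    have u1 : `|u| < 1 by lra.
    have := @sums_toZr _ _ _ (xi `^ nu)^-1 (hG u u1).
    rewrite /phibar_real mulrCA mulrC mulKf//.
    by move=> /eq_sums_to; apply => k; rewrite mulrAC.
  exact: small_xi_expansion.
by rewrite (exprNn xi) /binom_coef; set e := (-1) ^+ m; ring.
Qed.

Lemma pochhammer_opp (x : R) t : pochhammer (- x) t = (-1) ^+ t * falling x t.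
Proof.
rewrite /pochhammer /falling -[X in (-1) ^+ X](card_ord t) -prodrN.
by apply: eq_bigr => i _; rewrite opprB addrC.
Qed.

(** The exponents of 1 - u are now positive for large m, so the Pochhammer symbols have arguments
    -alpha (m + a); [pochhammer_opp] turns them into falling factorials, whence the sign (-1)^t. *)
Lemma large_xi_coefficients (a : R) (G : nat -> R) : 1 < xi ->
  (forall u : R, `|u| < 1 -> sums_to (fun t => G t * u ^+ t)
    (((1 - u) `^ alpha) `^ a * phibar_real u)) ->
  forall t, abs_sums_to (fun m : nat =>
      (-1) ^+ m * pochhammer nu m * xi ^- m / m`!%:R
      * falling (alpha * (m%:R + a)) t)
    ((-1) ^+ t * (G t * t`!%:R)).
Proof.
move=> xi1 hG t; have /andP[al0 _] := alpha01.
have xi0 : 0 < xi by lra.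
have y01 : 0 < xi^-1 < 1 by rewrite invr_gt0 xi0 invf_lt1.
have c_le m : `|- (alpha * (m%:R + a))| <= alpha * (m%:R + `|a|).
  rewrite normrN normrM (gtr0_norm al0) ler_pM2l//.
  by apply: le_trans (ler_normD _ _) _; rewrite normr_nat.
have r0 : 0 < Num.min 1 (xi - 1) by rewrite lt_min ltr01/=; lra.
have := @coefficient_series _ alpha nu xi^-1 `|a| (Num.min 1 (xi - 1))
  (fun m => - (alpha * (m%:R + a))) G alpha01 y01 c_le r0.
move=> /(_ _ t) h; apply: eq_abs_sums_to (@abs_sums_toZ _ _ _ ((-1) ^+ t) (h _)) _.
  move=> u; rewrite lt_min => /andP[u1 ur].
  exists (((1 - u) `^ alpha) `^ a * phibar_real u); first exact: hG.
  have := @large_xi_expansion _ alpha nu xi alpha01 xi0 u a xi1 u1 ur.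
  by move=> /eq_sums_to; apply => m; rewrite opprK.
move=> m /=; rewrite pochhammer_opp.
rewrite [LHS](_ : _ = ((-1) ^+ t * (-1) ^+ t) *
  (binom_coef nu m * (- xi^-1) ^+ m * falling (alpha * (m%:R + a)) t));
  last by set e := (-1) ^+ t; ring.
by rewrite -expr2 sqrr_sign mul1r (exprNn xi^-1) exprVn /binom_coef; set e := (-1) ^+ m; ring.
Qed.

End Phibar.

(** The binomial series at q g with g = 1 - v, where 1 - q g = q (xi + v); the positive factor q
    leaves the principal power, and (p / q)^nu = xi^nu. *)
Lemma phibar_mixture {R : realType} (alpha nu p q xi : R) (u : R[i]) :
  0 < p -> p < 1 -> q = 1 - p -> xi = p / q ->
  normc (1 - cpow (1 - u) alpha) <= 1 ->
  csums_to (fun k => (binom_coef nu k * p `^ nu * q ^+ k)%:C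
                     * (1 - cpow (1 - u) alpha) ^+ k) (phibar alpha nu xi u).
Proof.
move=> p0 p1 hq hxi g1; set v := cpow (1 - u) alpha in g1 *.
have q0 : 0 < q by lra.
have qg : normc (q%:C * (1 - v)) < 1.
  rewrite normcM normc_real gtr0_norm//.
  by have := normc_ge0 (1 - v); nra.
have E : 1 - q%:C * (1 - v) = q%:C * (xi%:C + v).
  have pq : p = 1 - q by lra.
  have -> : xi%:C = (1 - q%:C) / q%:C by rewrite hxi fmorph_div pq rmorphB rmorph1.
  by field; rewrite -[0]/(0%:C) (inj_eq (@complexI _)) gt_eqF.
have := csums_toZ (p `^ nu)%:C (complex_binomial_series nu qg).
rewrite E cpow_scale// invfM mulrA -fmorphV -rmorphM.
have -> : p `^ nu / q `^ nu = xi `^ nu.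
  by rewrite hxi powRM ?invr_ge0 ?ltW// -[q^-1](powR_inv1 (ltW q0)) -powRrM mulN1r powRN.
move=> /eq_csums_to; apply => k.
by rewrite exprMn !rmorphM rmorphXn; ring.
Qed.

(** * Identification of the coefficients of [phibar] and of the law of Z *)

Theorem mainTheorem1 (R : realType) (alpha nu p q xi : R)
  (halpha0 : 0 < alpha) (halpha1 : alpha <= 1) (hnu : 0 < nu)
  (hp0 : 0 < p) (hp1 : p < 1) (hq : q = 1 - p) (hxi : xi = p / q)
  (d : measure_display) (T : measurableType d) (P : probability T R)
  (N : {RV P >-> nat}) (Y : nat -> {RV P >-> nat})
  (hNpos : forall w, (0 < N w)%N)
  (hN : forall k : nat, (0 < k)%N ->
     P [set w | N w = k] =
       (pochhammer nu k.-1 / (k.-1)`!%:R * p `^ nu * q ^+ k.-1)%:E)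
  (hYindep : mutually_independent P Y)
  (hYid : identically_distributed P Y)
  (hNY : independent_of_seq P N Y)
  (hY : forall u : R[i], `|u| <= 1 ->
     gen_fun P (Y 0%N) u = 1 - cpow (1 - u) alpha) :
  let Z := random_sum N Y in
  (forall u : R[i], `|u| <= 1 ->
     gen_fun P Z u = (1 - cpow (1 - u) alpha) * phibar alpha nu xi u) /\
  (exists phi : nat -> R, power_series_at0 (phibar alpha nu xi) phi) /\
  (forall phi : nat -> R, power_series_at0 (phibar alpha nu xi) phi ->
   forall t : nat,
     (0 < xi < 1 ->
        (exists2 s : R,
           abs_sums_to (fun m : nat =>
             (-1) ^+ m * pochhammer nu m * xi ^+ m / m`!%:R
             * pochhammer (alpha * (m%:R + nu)) t) s
           & phi t = xi `^ nu / t`!%:R * s) /\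
        (exists2 s : R,
           abs_sums_to (fun m : nat =>
             (-1) ^+ m * pochhammer nu m * xi ^+ m / m`!%:R
             * (pochhammer (alpha * (m%:R + nu)) t
                - pochhammer (alpha * (m%:R - 1 + nu)) t)) s
           & P [set w | Z w = t] = (xi `^ nu / t`!%:R * s)%:E)) /\
     (1 < xi ->
        (exists2 s : R,
           abs_sums_to (fun m : nat =>
             (-1) ^+ m * pochhammer nu m * xi ^- m / m`!%:R
             * falling (alpha * m%:R) t) s
           & phi t = (-1) ^+ t / t`!%:R * s) /\
        (exists2 s : R,
           abs_sums_to (fun m : nat =>
             (-1) ^+ m * pochhammer nu m * xi ^- m / m`!%:R
             * (falling (alpha * m%:R) t - falling (alpha * m.+1%:R) t)) s
           & P [set w | Z w = t] = ((-1) ^+ t / t`!%:R * s)%:E))).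
Proof.
move=> Z.
have q0 : 0 < q by lra.
have xi0 : 0 < xi by rewrite hxi divr_gt0.
have alpha01 : 0 < alpha <= 1 by rewrite halpha0.
pose y n := fine (P (Y 0%N @^-1` [set n])).
pose w k := fine (P (N @^-1` [set k.+1])).
pose pz n := fine (P (Z @^-1` [set n])).
have wE k : w k = binom_coef nu k * p `^ nu * q ^+ k.
  by rewrite /w (hN k.+1).
have mY0 n : measurable (Y 0%N @^-1` [set n]) by exact: measurable_RV_preimage.
have mN n : measurable (N @^-1` [set n]) by exact: measurable_RV_preimage.
have mZ n : measurable (Z @^-1` [set n]) by exact: measurable_random_sum.
have y_ge0 n : 0 <= y n by rewrite fine_ge0.
have w_ge0 k : 0 <= w k by rewrite fine_ge0.
have y_sum : sums_to y 1 by exact: pmf_sum.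
have w_sum : cvgn (series w) by exact: cvgP (sums_to_behead (@pmf_sum _ _ _ P _ mN)).
have norm_le1 (u : R[i]) : (`|u| <= 1) = (normc u <= 1).
  by rewrite normC_real -[1]/(1%:C) lecR.
have hg (u : R[i]) : normc u <= 1 ->
    csums_to (fun n => (y n)%:C * u ^+ n) (1 - cpow (1 - u) alpha).
  by move=> u1; rewrite -hY ?norm_le1//; exact: gen_fun_csums_to.
have hmix (u : R[i]) : normc u <= 1 ->
    csums_to (fun k => (w k)%:C * (1 - cpow (1 - u) alpha) ^+ k) (phibar alpha nu xi u).
  move=> u1; have := phibar_mixture nu hp0 hp1 hq hxi (gen_fun_normc_le1 y_ge0 y_sum u1 (hg u u1)).
  by move=> /eq_csums_to; apply => k; rewrite wE.
(* The term for N = 0 vanishes since N is positive; dropping it shifts the index by one. *)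
have pzE n : sums_to (fun k => w k * conv_power y (k + 1) n) (pz n).
  have := sums_to_behead (@pmf_random_sum _ _ _ P Y hYindep hYid N hNY n).
  have -> : N @^-1` [set 0%N] = set0.
    by apply/seteqP; split=> // t /= Nt; have := hNpos t; rewrite Nt.
  rewrite measure0 /= mul0r subr0.
  by move=> /eq_sums_to; apply => k; rewrite addn1.
                                               
(* [phi0] is the law of Y_1 + ... + Y_(N-1), the candidate for the coefficients of [phibar]. *)
have /choice[phi0 phi0E] : forall n, exists s, sums_to (fun k => w k * conv_power y (k + 0) n) s.
  move=> n; apply: dominated_sums_to w_sum => k.
  have c0 j : 0 <= conv_power y k j by exact: conv_power_ge0.
  rewrite addn0 ger0_norm ?mulr_ge0// ler_piMr//.
  exact: ge0_sums_to_term_le c0 (conv_power_sum y_ge0 y_sum k).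
have hpz (u : R[i]) : normc u <= 1 -> csums_to (fun n => (pz n)%:C * u ^+ n)
    ((1 - cpow (1 - u) alpha) * phibar alpha nu xi u).
  move=> u1; apply: (mixture_gen_fun y_ge0 y_sum u1 w_ge0 w_sum (hg u u1) _ pzE).
  apply: (eq_csums_to (csums_toZ _ (hmix u u1))) => k.
  by rewrite addn1 exprS; ring.
have hphi0 (u : R[i]) : normc u <= 1 ->
    csums_to (fun n => (phi0 n)%:C * u ^+ n) (phibar alpha nu xi u).
  move=> u1; apply: (mixture_gen_fun y_ge0 y_sum u1 w_ge0 w_sum (hg u u1) _ phi0E).
  by apply: (eq_csums_to (hmix u u1)) => k; rewrite addn0.
have real_sums (c : nat -> R) (u : R) (s : R[i]) :
    csums_to (fun n => (c n)%:C * u%:C ^+ n) s -> sums_to (fun n => c n * u ^+ n) (complex.Re s).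
  by move=> [h _]; apply: (eq_sums_to h) => n; rewrite -rmorphXn -rmorphM.
have real_normc (u : R) : `|u| < 1 -> normc u%:C <= 1.
  by move=> u1; rewrite normc_real ltW.
have hphi0R (u : R) : `|u| < 1 ->
    sums_to (fun n => phi0 n * u ^+ n) (phibar_real alpha nu xi u).
  move=> u1; have := real_sums _ _ _ (hphi0 _ (real_normc u u1)).
  by rewrite phibar_realE.
have hpzR (u : R) : `|u| < 1 ->
    sums_to (fun n => pz n * u ^+ n) ((1 - (1 - u) `^ alpha) * phibar_real alpha nu xi u).
  move=> u1; have := real_sums _ _ _ (hpz _ (real_normc u u1)).
  by rewrite phibar_realE// cpow_one_minus_real// -(rmorph1 (real_complex R)) -rmorphB -rmorphM.
(* Since 1 - (1 - v) = v, the difference of the two sequences has the generating function v *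
   [phibar], to which the coefficient lemmas apply. *)
have hdR (u : R) : `|u| < 1 ->
    sums_to (fun n => (phi0 n - pz n) * u ^+ n) ((1 - u) `^ alpha * phibar_real alpha nu xi u).
  move=> u1; have := sums_toB (hphi0R u u1) (hpzR u u1).
  rewrite [X in sums_to _ X](_ : _ = (1 - u) `^ alpha * phibar_real alpha nu xi u); last ring.
  by move=> /eq_sums_to; apply => n; rewrite mulrBl.
split; [|split].
- move=> u; rewrite norm_le1 => u1.
  by apply: csums_to_unique (hpz u u1); exact: gen_fun_csums_to.
- exists phi0, 1 => // u; rewrite normC_real ltcR => u1.
  by apply/csums_toP/hphi0/ltW.
move=> phi [r r0 hphi] t.
(* Both sequences represent [phibar] at real points near 0, so they coincide. *)
have -> : phi = phi0.
  apply: (@power_series_unique _ (Num.min r 1)); first by rewrite lt_min r0 ltr01.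
  move=> u; rewrite lt_min => /andP[ur u1].
  exists (phibar_real alpha nu xi u); last exact: hphi0R.
  have := hphi u%:C; rewrite normC_real normc_real ltcR => /(_ ur) /csums_toP /real_sums.
  by rewrite phibar_realE.
have xin : xi `^ nu != 0 by rewrite gt_eqF// powR_gt0.
have ft : t`!%:R != 0 :> R by rewrite pnatr_eq0 -lt0n fact_gt0.
have PZ : P [set w | Z w = t] = (pz t)%:E by rewrite fineK// fin_num_measure.
split=> [xi01|xi1].
- have H1 := @small_xi_coefficients _ alpha nu xi alpha01 nu phi0 xi01 _ t.
  have H2 := @small_xi_coefficients _ alpha nu xi alpha01 (nu - 1)
    (fun n => phi0 n - pz n) xi01 _ t.
  have {}H1 : abs_sums_to (fun m : nat =>
      (-1) ^+ m * pochhammer nu m * xi ^+ m / m`!%:R * pochhammer (alpha * (m%:R + nu)) t)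
      (phi0 t / xi `^ nu * t`!%:R).
    by apply: H1 => u u1; rewrite subrr powRr0 mul1r; exact: hphi0R.
  split; first by exists (phi0 t / xi `^ nu * t`!%:R) => //; field; rewrite xin ft.
  (* The law of Z at t is recovered as phi0 - (phi0 - pz), from the expansions with a = nu and a =
     nu - 1. *)
  exists (phi0 t / xi `^ nu * t`!%:R - (phi0 t - pz t) / xi `^ nu * t`!%:R).
    apply: (eq_abs_sums_to (abs_sums_toB H1 (H2 _))) => [u u1|m].
      rewrite (_ : nu - (nu - 1) = 1); last ring.
      by rewrite powRr1 ?powR_ge0//; exact: hdR.
    by rewrite -mulrBr addrA addrAC.
  by rewrite PZ; congr EFin; field; rewrite xin ft.
- have s2 : (-1) ^+ t * (-1) ^+ t = 1 :> R by rewrite -expr2 sqrr_sign.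
  have H1 := @large_xi_coefficients _ alpha nu xi alpha01 0 phi0 xi1 _ t.
  have H2 := @large_xi_coefficients _ alpha nu xi alpha01 1 (fun n => phi0 n - pz n) xi1 _ t.
  have {}H1 : abs_sums_to (fun m : nat =>
      (-1) ^+ m * pochhammer nu m * xi ^- m / m`!%:R * falling (alpha * m%:R) t)
      ((-1) ^+ t * (phi0 t * t`!%:R)).
    apply: (eq_abs_sums_to (H1 _)) => [u u1|m]; last by rewrite addr0.
    by rewrite powRr0 mul1r; exact: hphi0R.
  split.
    exists ((-1) ^+ t * (phi0 t * t`!%:R)) => //.
    by rewrite mulrACA mulrA mulrACA s2; field.
  exists ((-1) ^+ t * (phi0 t * t`!%:R) - (-1) ^+ t * ((phi0 t - pz t) * t`!%:R)).
    apply: (eq_abs_sums_to (abs_sums_toB H1 (H2 _))) => [u u1|m].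
      by rewrite powRr1 ?powR_ge0//; exact: hdR.
    by rewrite -mulrBr natr1.
  rewrite PZ; congr EFin.
  rewrite [RHS](_ : _ = (-1) ^+ t * (-1) ^+ t * pz t); first by rewrite s2 mul1r.
  by field.
Qed.
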